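(* Let $\mathbb{F}_q$ be a finite field with $q$ elements, $q\neq 2$. If $n$ and $k$ are positive integers such that $q^n>(k-1)^4$, then every $n\times n$ matrix $A$ over $\mathbb{F}_q$ is a sum of two $k$-th powers, i.e. there exist $n\times n$ matrices $B,C$ over $\mathbb{F}_q$ such that $A=B^k+C^k$. *)

(* Defs.v *)
From mathcomp Require Export all_boot all_order all_algebra.

Set Implicit Arguments.
Unset Strict Implicit.
Unset Printing Implicit Defensive.

(* Main.v *)
(* Idea. If A is the scalar matrix a, embed the field L with #|F| ^ n elements in
   the matrices: for a != 0 the equation x ^+ k + y ^+ k = a is solvable in L by
   a Weil-type estimate, proved here by averaging over the classes of L^* modulo
   k-th powers instead of using Gauss and Jacobi sums.

   If A is not scalar and f, g are monic of degree n, g has a root in F and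
   tr f + tr g = \tr A, then A = B + C with B, C of characteristic polynomials f
   and g: both are completed from a principal submatrix by choosing a free first
   row.  By Cayley-Hamilton, B is a k-th power as soon as f divides h ^+ k - 'X for
   some h, e.g. if f is the minimal polynomial of a k-th power generating L.  So it
   remains to match traces, for which a second moment computation shows that the
   k-th powers of L take all nonzero traces; for n = 2 some of these k-th powers may
   lie in F, which is repaired by a combinatorial argument on sums of two k-th
   powers of F. *)
Require Import Defs.
From mathcomp Require Import all_boot all_order all_algebra.
From mathcomp Require Import all_field all_fingroup all_solvable.
From mathcomp Require Import ring lra zify.
Import Order.TTheory GRing.Theory Num.Theory.
Set Implicit Arguments.
Unset Strict Implicit.
Unset Printing Implicit Defensive.
Local Open Scope ring_scope.

(** * Matrices with prescribed characteristic polynomials *)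

(** With d roots of unity of order dividing k and e = d - 1, the function [dev] is the sum of the e
    nontrivial multiplicative characters chi with chi^k = 1. Let Q be the size of L. The square norm
    of [dev] is (Q - 1) e, a further convolution with [dev] multiplies it by at most e^2 Q, and
    evaluating an invariant function at one point costs e / (Q - 1): in all e^4 Q. Unsolvability of
    x^k + y^k = a would give a value -Q there, whence the condition Q > e^4, up to a correction at
    0.

    In the non-scalar case a single free first row is shared by B and C. It is spent on B, so C can
    only be block triangular, which is why one of the two polynomials needs a root. For n > 2 that
    polynomial is 'X - y^k times a minimal polynomial of degree n - 1 > 1, which has no root and is
    thus coprime to it; y is 0 or 1, to leave a nonzero trace for the other side. For n = 2 the
    second factor is linear too: both roots lie in F, a double root must be a k-th power to first
    order, and the cases of characteristic 2 and of k divisible by the characteristic need their own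
    count. *)

Lemma size_sub_lead (F : fieldType) m (p r : {poly F}) :
    p \is monic -> size p = m.+1 -> (size r <= m.+1)%N ->
  (size (r - r`_m *: p)%R <= m)%N.
Proof.
move=> p_mon szp szr; apply/leq_sizeP => j.
rewrite leq_eqVlt coefB coefZ => /predU1P [<-|lt_mj].
  by have := monicP p_mon; rewrite lead_coefE szp /= => ->; rewrite mulr1 subrr.
by rewrite [p`_j]nth_default ?szp // [r`_j]nth_default ?mulr0 ?subrr ?(leq_trans szr).
Qed.

Lemma size_sub_monic (F : fieldType) m (p r : {poly F}) :
    p \is monic -> r \is monic -> size p = m.+1 -> size r = m.+1 ->
  (size (r - p)%R <= m)%N.
Proof.
move=> p_mon r_mon szp szr; have := size_sub_lead p_mon szp (eq_leq szr).
by have := monicP r_mon; rewrite lead_coefE szr /= => ->; rewrite scale1r.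
Qed.

Section Controllable.
Variable F : fieldType.

(* Controllability of (M, v), phrased through y = \adj('X - M) v: every polynomial
   of degree less than m is a combination of the entries of y. *)
Definition controllable m (M : 'M[F]_m) (v : 'cV[F]_m) : Prop :=
  exists2 y : 'cV[{poly F}]_m,
    char_poly_mx M *m y = char_poly M *: map_mx polyC v &
    forall r : {poly F}, (size r <= m)%N ->
      exists rho : 'rV[F]_m, (map_mx polyC rho *m y) 0 0 = r.

Lemma char_poly_mx_bordered m (x : F) rho v (M : 'M[F]_m) :
  char_poly_mx (block_mx x%:M rho v M : 'M_(1 + m)) =
  block_mx ('X - x%:P)%:M (- map_mx polyC rho)
           (- map_mx polyC v) (char_poly_mx M).
Proof.
rewrite /char_poly_mx map_block_mx (scalar_mx_block 1 m 'X) raddfB /=.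
by rewrite map_scalar_mx /= opp_block_mx add_block_mx !sub0r.
Qed.

(** A Schur complement without fractions: multiplying on the right by [T] clears the block below the
    corner, and [\det T] is [char_poly M], a nonzero polynomial that can be cancelled. *)
Lemma char_poly_bordered m (x : F) rho v (M : 'M[F]_m) y :
    char_poly_mx M *m y = char_poly M *: map_mx polyC v ->
  char_poly (block_mx x%:M rho v M : 'M_(1 + m)) =
  ('X - x%:P) * char_poly M - (map_mx polyC rho *m y) 0 0.
Proof.
move=> My; have nz : char_poly M != 0 by rewrite monic_neq0 ?char_poly_monic.
apply: (mulIf nz); set p := _ - _.
pose T : 'M[{poly F}]_(1 + m) := block_mx (char_poly M)%:M 0 y 1%:M.
have detT : \det T = char_poly M.
  by rewrite /T (@det_lblock _ 1 m) det_scalar1 det1 mulr1.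
have MT : char_poly_mx (block_mx x%:M rho v M : 'M_(1 + m)) *m T =
    block_mx p%:M (- map_mx polyC rho) 0 (char_poly_mx M).
  rewrite char_poly_mx_bordered /T mulmx_block !mulmx0 !mulmx1 !add0r.
  rewrite -scalar_mxM My mul_mx_scalar scalerN addNr mulNmx /p.
  congr block_mx; rewrite [map_mx _ _ *m y]mx11_scalar -raddfB /=.
  by rewrite !mxE.
by rewrite -{1}detT /char_poly -det_mulmx MT (@det_ublock _ 1 m) det_scalar1.
Qed.

(** Pole placement: the corner [x] adjusts the coefficient of degree m, and the row [rho] all lower
    ones, by controllability. *)
Lemma controllable_char_poly m (M : 'M[F]_m) v (f : {poly F}) :
    controllable M v -> f \is monic -> size f = m.+2 ->
  exists x rho, char_poly (block_mx x%:M rho v M : 'M_(1 + m)) = f.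
Proof.
case=> y My span_y f_mon szf.
have chM := char_poly_monic M; have szM := size_char_poly M.
pose r := 'X * char_poly M - f.
have szr : (size r <= m.+1)%N.
  apply: size_sub_monic => //; rewrite ?monicMl ?monicX //.
  by rewrite mulrC size_mulX ?monic_neq0 ?szM.
have [rho Hrho] := span_y _ (size_sub_lead chM szM szr).
exists r`_m, rho; rewrite (char_poly_bordered _ _ My) Hrho -mul_polyC /r.
by ring.
Qed.

(** The new vector of polynomials is [char_poly M] on top of y: its top entry removes the
    coefficient of degree m, and y spans what remains. The first row stays arbitrary, hence is free
    for a later choice. *)
Lemma controllable_bordered m (x : F) rho v (M : 'M[F]_m) :
    controllable M v ->
  controllable (block_mx x%:M rho v M : 'M_(1 + m)) (col_mx 1%:M 0).
Proof.
case=> y My span_y.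
have chM := char_poly_monic M; have szM := size_char_poly M.
exists (col_mx (char_poly M)%:M y) => [|r szr].
  rewrite (char_poly_bordered x rho My) char_poly_mx_bordered.
  rewrite mul_block_col -scalar_mxM map_col_mx map_mx0 scale_col_mx scaler0.
  rewrite mulNmx mulNmx My mul_mx_scalar addNr; congr col_mx.
  rewrite [map_mx _ _ *m y]mx11_scalar -raddfB /= map_scalar_mx /=.
  by rewrite scale_scalar_mx mulr1 [in RHS]mxE.
have [rho' Hrho] := span_y _ (size_sub_lead chM szM szr).
exists (row_mx (r`_m)%:M rho'); rewrite map_row_mx mul_row_col mxE Hrho.
by rewrite map_scalar_mx -scalar_mxM !mxE /= mulr1n mul_polyC addrC subrK.
Qed.

Lemma controllable_scale m (M : 'M[F]_m) v c :
  c != 0 -> controllable M v -> controllable M (c *: v).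
Proof.
move=> nzc [y My span_y]; exists (c%:P *: y) => [|r szr].
  by rewrite -scalemxAr My map_mxZ !scalerA mulrC.
have [rho Hrho] := span_y r szr.
exists (c^-1 *: rho); rewrite map_mxZ -scalemxAl -scalemxAr scalerA -polyCM.
by rewrite mulVf // scale1r.
Qed.

Lemma char_poly_mx_conj m (P M : 'M[F]_m) : P \in unitmx ->
  char_poly_mx (P *m M *m invmx P) =
  map_mx polyC P *m char_poly_mx M *m map_mx polyC (invmx P).
Proof.
move=> uP; rewrite /char_poly_mx mulmxBr mulmxBl !map_mxM; congr (_ - _).
by rewrite mul_mx_scalar -scalemxAl -map_mxM mulmxV // map_mx1 scalemx1.
Qed.

Lemma char_poly_conj m (P M : 'M[F]_m) : P \in unitmx ->
  char_poly (P *m M *m invmx P) = char_poly M.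
Proof.
move=> uP; rewrite /char_poly char_poly_mx_conj // !det_mulmx mulrAC.
by rewrite -det_mulmx -map_mxM mulmxV // map_mx1 det1 mul1r.
Qed.

Lemma controllable_conj m (P M : 'M[F]_m) v : P \in unitmx ->
  controllable M v -> controllable (P *m M *m invmx P) (P *m v).
Proof.
move=> uP [y My span_y]; exists (map_mx polyC P *m y) => [|r szr].
  rewrite char_poly_mx_conj // char_poly_conj // -!mulmxA.
  rewrite (mulmxA (map_mx _ (invmx P))) -map_mxM mulVmx // map_mx1 mul1mx My.
  by rewrite -scalemxAr map_mxM.
have [rho Hrho] := span_y r szr.
exists (rho *m invmx P); rewrite map_mxM -mulmxA (mulmxA (map_mx _ (invmx P))).
by rewrite -map_mxM mulVmx // map_mx1 mul1mx.
Qed.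

Lemma col_first_basis m (v : 'cV[F]_(1 + m)) : v != 0 ->
  exists2 P : 'M[F]_(1 + m), P \in unitmx & v = P *m col_mx 1%:M 0.
Proof.
move=> nzv; have rv : \rank v = 1%N.
  by apply/eqP; rewrite eqn_leq rank_leq_col lt0n mxrank_eq0.
pose c := row_ebase v 0 0.
have nzc : c != 0.
  have := row_ebase_unit v; rewrite [row_ebase v]mx11_scalar unitmxE.
  by rewrite det_scalar1 unitfE.
exists (c *: col_ebase v); first by rewrite unitmxZ ?col_ebase_unit ?unitfE.
rewrite -[v in LHS]mulmx_ebase rv [row_ebase v]mx11_scalar -/c mul_mx_scalar.
rewrite -scalemxAl; congr (c *: (_ *m _)).
by apply/matrixP=> i j; rewrite !mxE !ord1; case: splitP => k ->; rewrite ?ord1 !mxE.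
Qed.

Hypothesis cardF : exists c : F, (c != 0) && (c != 1).

(* This is where #|F| > 2 is needed: the entry of A below the diagonal must be
   split into two nonzero summands. *)
Lemma controllable_split m (A : 'M[F]_m) v (g : {poly F}) :
    (0 < m)%N ==> (v != 0) -> g \is monic -> size g = m.+1 ->
  exists C, [/\ char_poly C = g, controllable C v & controllable (A - C) v].
Proof.
elim: m A v g => [|m IHm] A v g /= nzv g_mon szg.
  have ctrl0 M w : @controllable 0 M w.
    exists 0 => [|r]; first by apply/matrixP=> -[].
    by rewrite leqn0 size_poly_eq0 => /eqP->; exists 0; rewrite mulmx0 mxE.
  exists 0; split=> //; rewrite /char_poly det_mx00.
  have := size1_polyC (eq_leq szg) => g_c; have := monicP g_mon.
  by rewrite g_c lead_coefC => ->.
have [P uP Dv] := @col_first_basis m v nzv.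
pose A' : 'M[F]_(1 + m) := invmx P *m A *m P.
(* If the column below the corner vanishes, any nonzero v' serves, since 0 = v' - v'. *)
pose a := dlsubmx A'; pose v' := if a == 0 then const_mx 1 else a.
have nzv' : (0 < m)%N ==> (v' != 0).
  apply/implyP=> m_gt0; rewrite /v'; case: ifPn => // _.
  apply/eqP=> /matrixP/(_ (Ordinal m_gt0) 0); rewrite !mxE; apply/eqP.
  exact: oner_neq0.
have [b [c [nzb nzc Dbc]]] : exists b c, [/\ b != 0, c != 0 & a = b *: v' + c *: v'].
  rewrite /v'; case: ifPn => [/eqP->|_].
    by exists 1, (- 1); rewrite oppr_eq0 oner_eq0 scale1r scaleN1r subrr.
  have [b /andP [nzb nb1]] := cardF; exists b, (1 - b).
  by rewrite nzb subr_eq0 eq_sym nb1 -scalerDl addrC subrK scale1r.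
(* The polynomial 'X^m is an arbitrary choice: only controllability of both parts is kept, and the
   new first row then produces g. *)
have [C1 [_ ctrlC ctrlAC]] : exists C1, [/\ char_poly C1 = 'X^m,
    controllable C1 v' & controllable (drsubmx A' - C1) v'].
  by apply: IHm; rewrite ?monicXn ?size_polyXn.
have [x [rho Dg]] :=
  controllable_char_poly (controllable_scale nzb ctrlC) g_mon szg.
pose C' : 'M[F]_(1 + m) := block_mx x%:M rho (b *: v') C1.
exists (P *m C' *m invmx P); rewrite char_poly_conj //; split=> //.
  by rewrite Dv; apply/controllable_conj/controllable_bordered/controllable_scale.
have -> : A - P *m C' *m invmx P = P *m (A' - C') *m invmx P.
  by rewrite mulmxBr mulmxBl /A' !mulmxA mulmxV // mul1mx mulmxK.
rewrite Dv; apply: controllable_conj => //.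
have -> : A' - C' =
    block_mx (ulsubmx A' 0 0 - x)%:M (ursubmx A' - rho) (c *: v') (drsubmx A' - C1).
  rewrite -[A' in LHS](submxK (A' : 'M_(1 + m, 1 + m))) /C' opp_block_mx add_block_mx.
  congr block_mx; last by rewrite -/a Dbc addrC addKr.
  by rewrite {1}[ulsubmx A']mx11_scalar raddfB.
exact/controllable_bordered/controllable_scale.
Qed.

(** If all basis vectors e_j are eigenvectors, A is diagonal; if each e_i + e_0 is one as well, the
    diagonal entries agree. *)
Lemma nonscalar_noneigen m (A : 'M[F]_m.+1) : ~~ is_scalar_mx A ->
  exists v : 'cV[F]_m.+1, forall x, A *m v != x *: v.
Proof.
move=> nscA; pose offdiag := [exists i, exists j, (i != j) && (A i j != 0)].
have colE j : A *m delta_mx j 0 = col j A by rewrite colE.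
have [/existsP [i /existsP [j /andP [ne_ij nz]]] | /existsPn diagA] := boolP offdiag.
  exists (delta_mx j 0) => x; apply/eqP => /matrixP/(_ i 0).
  by rewrite colE !mxE (negPf ne_ij) mulr0; apply/eqP.
have {}diagA i j : i != j -> A i j = 0.
  move=> ne_ij; have /existsPn/(_ j) := diagA i.
  by rewrite ne_ij /= negbK => /eqP.
have [/existsP [i ne_i0] | /existsPn all0] := boolP [exists i, A i i != A 0 0].
  have i0 : i != 0 by apply: contraNneq ne_i0 => ->.
  exists (delta_mx i 0 + delta_mx 0 0) => x; apply/eqP => eqv.
  move/matrixP: eqv => eqv; have := eqv 0 0; have := eqv i 0.
  rewrite mulmxDr !colE !mxE eqxx /= [0 == i]eq_sym ![i == _](negPf i0) /=.
  rewrite (diagA i 0) // (diagA 0 i) 1?eq_sym // !addr0 !add0r mulr1 => Di D0.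
  by rewrite Di D0 eqxx in ne_i0.
case/is_scalar_mxP: nscA; exists (A 0 0); apply/matrixP=> i j; rewrite !mxE.
have [<-|/diagA //] := eqVneq i j.
by apply/eqP; rewrite mulr1n -[_ == _]negbK all0.
Qed.

(** In a basis starting with a non-eigenvector the column below the corner is nonzero. B takes all
    of it and is steered to f by its first row; C is then block upper triangular with lower block of
    characteristic polynomial g. Its corner is not chosen: the trace condition forces it to be c. *)
Lemma nonscalar_sum m (A : 'M[F]_m.+1) (c : F) (f g : {poly F}) :
    ~~ is_scalar_mx A ->
    f \is monic -> size f = m.+2 -> g \is monic -> size g = m.+1 ->
    - f`_m - (('X - c%:P) * g)`_m = \tr A ->
  exists B C, [/\ A = B + C, char_poly B = f & char_poly C = ('X - c%:P) * g].
Proof.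
move=> nscA f_mon szf g_mon szg trA.
have [w wP] := nonscalar_noneigen nscA.
have nzw : w != 0 by apply: contraTneq (wP 0) => ->; rewrite mulmx0 scaler0 eqxx.
have [P uP Dw] := @col_first_basis m w nzw.
have [A' DA] : exists A' : 'M[F]_(1 + m), A = P *m A' *m invmx P.
  by exists (invmx P *m A *m P); rewrite !mulmxA mulmxV // mul1mx mulmxK.
pose v := dlsubmx A'.
have nzv : v != 0.
  apply: contraNneq (wP (ulsubmx A' 0 0)) => v0; apply/eqP.
  rewrite {1}DA Dw -!mulmxA mulKmx // scalemxAr; congr (P *m _).
  have -> : A' *m col_mx 1%:M 0 = col_mx (ulsubmx A') v.
    rewrite -[A' in LHS]submxK mul_block_col !mulmx1 !mulmx0 !addr0.
    by rewrite /v.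
  by rewrite v0 scale_col_mx scaler0 scalemx1 -mx11_scalar.
have [C1 [chC1 _ ctrl]] : exists C, [/\ char_poly C = g, controllable C v &
    controllable (drsubmx A' - C) v].
  by apply: controllable_split; rewrite ?nzv ?implybT.
have [x [rho Df]] := controllable_char_poly ctrl f_mon szf.
pose B' : 'M[F]_(1 + m) := block_mx x%:M rho v (drsubmx A' - C1).
pose y := ulsubmx A' 0 0 - x.
pose C' : 'M[F]_(1 + m) := block_mx y%:M (ursubmx A' - rho) 0 C1.
have DA' : A' = B' + C'.
  rewrite /B' /C' add_block_mx -raddfD /= /y addrC subrK -mx11_scalar.
  by rewrite addrC subrK addr0 subrK submxK.
have chC' : char_poly C' = ('X - y%:P) * g.
  rewrite /char_poly char_poly_mx_bordered map_mx0 oppr0 (@det_ublock _ 1 m).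
  by rewrite det_scalar1 -chC1.
exists (P *m B' *m invmx P), (P *m C' *m invmx P); split.
- by rewrite -mulmxDl -mulmxDr -DA' -DA.
- by rewrite char_poly_conj.
rewrite char_poly_conj // chC'; congr (('X - _%:P) * g).
have trA' : \tr A' = \tr A by rewrite DA mxtrace_mulC mulKmx.
have := @char_poly_trace F m.+1 B' isT.
have := @char_poly_trace F m.+1 C' isT.
rewrite chC' Df /= => trC trB.
move: trA; rewrite -trA' DA' raddfD /= -[\tr B']opprK -[\tr C']opprK -trB -trC.
move/addrI/oppr_inj; rewrite !mulrBl !coefB !coefCM.
have := monicP g_mon; rewrite lead_coefE szg /= => ->; rewrite !mulr1.
by move/addrI/oppr_inj.
Qed.

End Controllable.

(** * Equidistribution of k-th powers in a finite field *)
(** Lagrange's identity: twice the difference of the two sides is a sum of squares. *)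
Lemma Cauchy_Schwarz_sum (R : realFieldType) (I : finType) (a b : I -> R) :
  (\sum_i a i * b i) ^+ 2 <= (\sum_i a i ^+ 2) * (\sum_i b i ^+ 2).
Proof.
have ge0 : 0 <= \sum_i \sum_j (a i * b j - a j * b i) ^+ 2.
  by apply: sumr_ge0 => i _; apply: sumr_ge0 => j _; apply: sqr_ge0.
have E : \sum_i \sum_j (a i * b j - a j * b i) ^+ 2 =
    (\sum_i a i ^+ 2) * (\sum_i b i ^+ 2) *+ 2 - (\sum_i a i * b i) ^+ 2 *+ 2.
  set X := _ * _; set Y := _ ^+ 2.
  have X1 : X = \sum_i \sum_j a i ^+ 2 * b j ^+ 2.
    by rewrite /X mulr_suml; apply: eq_bigr => i _; rewrite mulr_sumr.
  have X2 : X = \sum_i \sum_j a j ^+ 2 * b i ^+ 2 by rewrite X1 exchange_big.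
  have Y1 : Y = \sum_i \sum_j (a i * b i) * (a j * b j).
    by rewrite /Y expr2 mulr_suml; apply: eq_bigr => i _; rewrite mulr_sumr.
  rewrite !mulr2n {1}X1 X2 Y1 -!big_split -sumrB; apply: eq_bigr => i _ /=.
  rewrite -!big_split -sumrB; apply: eq_bigr => j _ /=.
  by ring.
by move: ge0; rewrite E subr_ge0 ler_pMn2r.
Qed.

Section PowerFibres.
Variables (L : finFieldType) (k : nat).
Hypothesis k_gt0 : (0 < k)%N.

Definition nroots1 := #|[set x : L | x ^+ k == 1]|.
Definition nroots (v : L) := #|[set x : L | x ^+ k == v]|.
(* The excess of the number of k-th roots of v over its mean value 1. *)
Definition dev (v : L) : rat := (nroots v)%:R - 1.
Local Notation Q := (#|L|%:R : rat).
Local Notation e := (nroots1%:R - 1 : rat).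

Lemma nroots1_gt0 : (0 < nroots1)%N.
Proof. by apply/card_gt0P; exists 1; rewrite inE expr1n. Qed.

Lemma nroots_pow y : y != 0 -> nroots (y ^+ k) = nroots1.
Proof.
move=> nzy; rewrite /nroots /nroots1 -[RHS](card_imset _ (mulfI nzy)).
apply: eq_card => x; rewrite [LHS]inE; apply/eqP/imsetP => [xy|[z]].
  exists (x / y); last by rewrite mulrC divfK.
  by rewrite inE expr_div_n xy divff ?expf_neq0.
by rewrite inE => /eqP z1 ->; rewrite exprMn z1 mulr1.
Qed.

Lemma nroots0 : nroots 0 = 1%N.
Proof.
apply/eqP/cards1P; exists 0; apply/setP=> x.
by rewrite !inE expf_eq0 k_gt0.
Qed.

Lemma dev0 : dev 0 = 0. Proof. by rewrite /dev nroots0 subrr. Qed.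

Lemma nroots_scale v y : y != 0 -> nroots (v * y ^+ k) = nroots v.
Proof.
move=> nzy; rewrite /nroots -[RHS](card_imset _ (mulfI nzy)).
apply: eq_card => x; rewrite [LHS]inE; apply/eqP/imsetP => [xy|[z]].
  exists (x / y); last by rewrite mulrC divfK.
  by rewrite inE expr_div_n xy mulfK ?expf_neq0.
by rewrite inE => /eqP z1 ->; rewrite exprMn z1 mulrC.
Qed.

Lemma dev_scale v y : y != 0 -> dev (v * y ^+ k) = dev v.
Proof. by move=> nzy; rewrite /dev nroots_scale. Qed.

Lemma sum_dev_mul (g : L -> rat) :
  \sum_v dev v * g v = \sum_x g (x ^+ k) - \sum_v g v.
Proof.
rewrite (eq_bigr (fun v => (nroots v)%:R * g v - g v)); last first.
  by move=> v _; rewrite /dev mulrBl mul1r.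
rewrite sumrB; congr (_ - _).
rewrite [RHS](partition_big (fun x => x ^+ k) xpredT) //=; apply: eq_bigr => v _.
rewrite [RHS](eq_bigr (fun=> g v)) => [|x /eqP <- //].
rewrite sumr_const mulr_natl /nroots; congr (_ *+ _).
by apply: eq_card => x; rewrite inE.
Qed.

Lemma sum_dev : \sum_v dev v = 0.
Proof.
have := sum_dev_mul (fun=> 1); rewrite subrr => D1; rewrite -[RHS]D1.
by apply: eq_bigr => v _; rewrite mulr1.
Qed.

Lemma sumr_neq0 (g : L -> rat) c : g 0 = 0 -> (forall x, x != 0 -> g x = c) ->
  \sum_x g x = (Q - 1) * c.
Proof.
move=> g0 gc; rewrite (bigD1 0) //= g0 add0r (eq_bigr (fun=> c)) //.
rewrite sumr_const -[LHS]mulr_natl; congr (_ * _).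
by rewrite -[#|L|](ltn_predK (finNzRing_gt1 L)) -(cardC1 (0 : L)) -natr1 addrK.
Qed.

Lemma sum_dev_sqr : \sum_v dev v ^+ 2 = (Q - 1) * e.
Proof.
rewrite (eq_bigr (fun v => dev v * dev v)) ?sum_dev_mul ?sum_dev ?subr0 //.
apply: sumr_neq0 => [|x nzx]; first by rewrite expr0n gtn_eqF // dev0.
by rewrite /dev nroots_pow.
Qed.

Lemma card_gt1 : 0 < Q - 1.
Proof. by rewrite subr_gt0 ltr1n finNzRing_gt1. Qed.

(* Testing D against dev: both are constant on cosets of the k-th powers, and
   \sum_l dev l * D l only sees the coset of 1. *)
Lemma invariant_bound (D : L -> rat) :
    D 0 = 0 -> (forall l y, y != 0 -> D (l * y ^+ k) = D l) ->
    \sum_l D l = 0 ->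
  (Q - 1) * D 1 ^+ 2 <= e * \sum_l D l ^+ 2.
Proof.
move=> D0 Dinv sumD; have Q1 := card_gt1.
have E : \sum_l dev l * D l = (Q - 1) * D 1.
  rewrite sum_dev_mul sumD subr0; apply: sumr_neq0 => [|x nzx].
    by rewrite expr0n gtn_eqF.
  by rewrite -[_ ^+ _]mul1r Dinv.
have := Cauchy_Schwarz_sum dev D; rewrite E sum_dev_sqr exprMn expr2 -!mulrA.
by rewrite ler_pM2l.
Qed.

Lemma sum_shift (g : L -> rat) u : \sum_v g (v + u) = \sum_v g v.
Proof.
rewrite [RHS](reindex_inj (addIr u)) /=.
by apply: eq_bigr.
Qed.

Lemma sum_scale (g : L -> rat) u : u != 0 -> \sum_v g (u * v) = \sum_v g v.
Proof. by move=> nzu; rewrite [RHS](reindex_inj (mulfI nzu)). Qed.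

(** The dilation l is there to be averaged over: the mean square over all l can be computed, and
    [invariant_bound] then returns to l = 1. *)
Definition conv (l : L) (g : L -> rat) v := \sum_u dev (l * u) * g (v - u).

(** Expanding the square leaves the autocorrelation [c t] of [dev], averaged over dilations.
    Rescaling l and u shows that it is constant for t != 0, and its total is 0, so [c 0] determines
    everything. The inequality only drops a negative multiple of the square of the sum of g. *)
Lemma sum_conv_sqr (g : L -> rat) :
  \sum_l \sum_v conv l g v ^+ 2 <= (Q - 1) * e * Q * \sum_v g v ^+ 2.
Proof.
pose c t := \sum_l \sum_u dev (l * u) * dev (l * (u + t)).
pose G t := \sum_v g v * g (v - t).
have -> : \sum_l \sum_v conv l g v ^+ 2 = \sum_t c t * G t.
  rewrite /c; under [RHS]eq_bigr => t _ do rewrite mulr_suml.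
  rewrite [RHS]exchange_big /=; apply: eq_bigr => l _.
  transitivity (\sum_v \sum_u \sum_t dev (l * u) * dev (l * (u + t)) *
                   (g (v - u) * g (v - u - t))).
    apply: eq_bigr => v _; rewrite /conv expr2 mulr_suml; apply: eq_bigr => u _.
    rewrite -(sum_shift _ u) mulr_sumr; apply: eq_bigr => t _.
    by rewrite [t + u]addrC opprD addrA; ring.
  rewrite exchange_big /=; under eq_bigr => u _ do rewrite exchange_big /=.
  rewrite exchange_big /=; apply: eq_bigr => t _; rewrite mulr_suml.
  apply: eq_bigr => u _; rewrite -mulr_sumr /G; congr (_ * _).
  rewrite -(sum_shift _ u); apply: eq_bigr => v _.
  by rewrite addrK.
have c0 : c 0 = (Q - 1) * ((Q - 1) * e).
  apply: sumr_neq0 => [|l nzl].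
    by apply: big1 => u _; rewrite mul0r dev0 mul0r.
  rewrite -sum_dev_sqr -(sum_scale (fun v => dev v ^+ 2) nzl).
  by apply: eq_bigr => u _; rewrite addr0 expr2.
have ct t : t != 0 -> c t = c 1.
  move=> nzt; rewrite /c.
  rewrite -[LHS](@sum_scale (fun l => \sum_u dev (l * u) * dev (l * (u + t))) t^-1);
    last by rewrite invr_eq0.
  apply: eq_bigr => l _.
  rewrite -(@sum_scale (fun u => dev (t^-1 * l * u) * dev (t^-1 * l * (u + t))) t) //.
  apply: eq_bigr => u _.
  congr (dev _ * dev _); first by rewrite mulrACA mulVf // mul1r.
  by rewrite -[X in _ + X]mulr1 -mulrDr mulrACA mulVf // mul1r.
have sumc : \sum_t c t = 0.
  rewrite /c exchange_big /= big1 // => l _; rewrite exchange_big /= big1 // => u _.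
  rewrite -mulr_sumr; have [->|nzl] := eqVneq l 0; first by rewrite mul0r dev0 mul0r.
  under eq_bigr => t _ do rewrite [u + t]addrC.
  by rewrite (sum_shift (fun t => dev (l * t))) sum_scale // sum_dev mulr0.
have c1 : c 1 = - ((Q - 1) * e).
  have Q1 := card_gt1.
  have : c 0 + (Q - 1) * c 1 = 0.
    rewrite -sumc (bigD1 (0 : L)) //=; congr (_ + _).
    pose h (t : L) := if t == 0 then 0 else c 1.
    have <- : \sum_t h t = (Q - 1) * c 1.
      by apply: sumr_neq0 => [|t]; rewrite /h ?eqxx // => /negPf ->.
    rewrite (bigD1 (0 : L)) //= /h eqxx add0r; apply: eq_bigr => t nzt.
    by rewrite (negPf nzt) ct.
  rewrite c0 -mulrDr => /eqP; rewrite mulf_eq0 (gt_eqF Q1) /= addrC addr_eq0.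
  by move/eqP.
have sumG : \sum_t G t = (\sum_v g v) ^+ 2.
  rewrite /G exchange_big /= expr2 mulr_suml; apply: eq_bigr => v _.
  rewrite -mulr_sumr; congr (_ * _).
  have oinj : injective (fun t => v - t : L) by move=> x y /addrI/oppr_inj.
  by rewrite [RHS](reindex_inj oinj).
have G0 : G 0 = \sum_v g v ^+ 2.
  by apply: eq_bigr => v _; rewrite subr0 expr2.
have -> : \sum_t c t * G t = (c 0 - c 1) * G 0 + c 1 * \sum_t G t.
  rewrite (bigD1 (0 : L)) //= [\sum_t G t](bigD1 (0 : L)) //= mulrDr addrA.
  rewrite mulrBl subrK; congr (_ + _); rewrite mulr_sumr.
  by apply: eq_bigr => t nzt; rewrite ct.
rewrite c0 c1 sumG -G0.
have := sqr_ge0 (\sum_v g v); have := card_gt1.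
have : 0 <= e by rewrite subr_ge0 ler1n nroots1_gt0.
set S := (\sum_v _) ^+ 2; set E := nroots1%:R - 1; set P := Q - 1 => E0 P0 S0.
have PES : 0 <= P * E * S by apply: mulr_ge0 => //; apply: mulr_ge0 => //; apply: ltW.
rewrite -subr_ge0; have -> : P * E * Q * G 0 -
   ((P * (P * E) - - (P * E)) * G 0 + - (P * E) * S) = P * E * S.
  by rewrite /P; ring.
by [].
Qed.

(* Convolution with dev has operator norm at most e * sqrt Q; this replaces the
   bound on Gauss sums. *)
Lemma conv_bound (g : L -> rat) :
  \sum_v conv 1 g v ^+ 2 <= e ^+ 2 * Q * \sum_v g v ^+ 2.
Proof.
have Q1 := card_gt1.
have e0 : 0 <= e by rewrite subr_ge0 ler1n nroots1_gt0.
rewrite -(ler_pM2l Q1).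
have step v : (Q - 1) * conv 1 g v ^+ 2 <= e * \sum_l conv l g v ^+ 2.
  apply: (@invariant_bound (fun l => conv l g v)).
  - by rewrite /conv big1 // => u _; rewrite mul0r dev0 mul0r.
  - move=> l y nzy; apply: eq_bigr => u _; congr (_ * _).
    by rewrite mulrAC dev_scale.
  rewrite /conv exchange_big /= big1 // => u _; rewrite -mulr_suml.
  have [->|nzu] := eqVneq u 0.
    by rewrite big1 ?mul0r // => l _; rewrite mulr0 dev0.
  under eq_bigr => l _ do rewrite mulrC.
  by rewrite sum_scale // sum_dev mul0r.
rewrite [leLHS]mulr_sumr; apply: (@le_trans _ _ (\sum_v e * \sum_l conv l g v ^+ 2)).
  exact: ler_sum.
rewrite -mulr_sumr exchange_big /=.
apply: le_trans (ler_wpM2l e0 (sum_conv_sqr g)) _.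
by rewrite le_eqVlt; apply/orP; left; apply/eqP; ring.
Qed.

Lemma sum_two_powers (a : L) :
  a != 0 -> ((nroots1 - 1) ^ 4 < #|L|)%N -> exists x y : L, x ^+ k + y ^+ k = a.
Proof.
move=> nza lt_e4; pose F v := conv 1 dev v.
have [/existsP [x /existsP [y /eqP <-]] | no_sol] :=
  boolP [exists x : L, [exists y : L, x ^+ k + y ^+ k == a]]; first by exists x, y.
have Q1 := card_gt1.
have e0 : 0 <= e by rewrite subr_ge0 ler1n nroots1_gt0.
have Fa : F a = - Q.
  have r0 u : (nroots u)%:R * (nroots (a - u))%:R = 0 :> rat.
    apply/eqP; rewrite -natrM pnatr_eq0 muln_eq0 !cards_eq0.
    apply: contraR no_sol; rewrite negb_or => /andP [/set0Pn [x] + /set0Pn [y]].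
    rewrite !inE => /eqP Dx /eqP Dy; apply/existsP; exists x; apply/existsP; exists y.
    by rewrite Dx Dy addrC subrK.
  have sumN : \sum_u dev (a - u) = 0.
    have oinj : injective (fun t => a - t : L) by move=> x y /addrI/oppr_inj.
    by rewrite -[RHS]sum_dev [RHS](reindex_inj oinj).
  have E u : dev (1 * u) * dev (a - u) = - dev u - dev (a - u) - 1.
    have := r0 u; rewrite mul1r /dev.
    set n1 := _%:R; set n2 := _%:R => n12.
    by rewrite mulrBl mulrBr n12; ring.
  rewrite /F /conv (eq_bigr _ (fun u _ => E u)) big_split big_split /=.
  by rewrite !sumrN sum_dev sumN oppr0 !add0r sumr_const.
(* [F] sums to 0 over L, so adding [kappa] off 0 gives a function with zero sum that vanishes at 0,
   as [invariant_bound] requires. The dilation by a in [D] moves the missing value to l = 1. *)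
pose kappa := F 0 / (Q - 1).
have F0 : F 0 = kappa * (Q - 1) by rewrite /kappa divfK ?gt_eqF.
have Finv l y : y != 0 -> F (l * y ^+ k) = F l.
  move=> nzy; have nzyk : y ^+ k != 0 by rewrite expf_neq0.
  rewrite /F /conv -[LHS](sum_scale _ nzyk); apply: eq_bigr => u _.
  by rewrite !mul1r ![y ^+ k * u]mulrC dev_scale // -mulrBl dev_scale.
have sumF : \sum_v F v = 0.
  rewrite /F /conv exchange_big /= big1 // => u _; rewrite -mulr_sumr.
  by rewrite (sum_shift dev) sum_dev mulr0.
pose D l := if l == 0 then 0 else F (a * l) + kappa.
have sumD0 (g : rat -> rat) : g 0 = 0 ->
    \sum_l g (D l) = \sum_l g (F l + kappa) - g (F 0 + kappa).
  move=> g0; rewrite (bigD1 (0 : L)) //= /D eqxx g0 add0r.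
  rewrite -(sum_scale (fun l => g (F l + kappa)) nza).
  rewrite [in RHS](bigD1 (0 : L)) //= mulr0 [X in X - _]addrC addrK.
  by apply: eq_bigr => l /negPf ->.
have card_sum (c : rat) : \sum_(l : L) c = Q * c by rewrite sumr_const -[LHS]mulr_natl.
have sumD : \sum_l D l = 0.
  by rewrite (sumD0 id) // big_split /= sumF card_sum F0; ring.
have sumD2 : \sum_l D l ^+ 2 = \sum_v F v ^+ 2 - kappa ^+ 2 * Q * (Q - 1).
  rewrite (sumD0 (fun x => x ^+ 2)) ?expr0n //.
  rewrite (eq_bigr (fun l => F l ^+ 2 + kappa *+ 2 * F l + kappa ^+ 2)); last first.
    by move=> l _; ring.
  rewrite !big_split /= card_sum -mulr_sumr sumF mulr0 F0.
  by ring.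
have bD : (Q - 1) * D 1 ^+ 2 <= e * \sum_l D l ^+ 2.
  apply: invariant_bound => //; first by rewrite /D eqxx.
  move=> l y nzy; rewrite /D mulf_eq0 (negPf (expf_neq0 k nzy)) orbF.
  by rewrite mulrA Finv.
have D2ge0 : 0 <= \sum_l D l ^+ 2 by apply: sumr_ge0 => l _; apply: sqr_ge0.
have bF := conv_bound dev; rewrite sum_dev_sqr -/F in bF.
have D1 : D 1 = kappa - Q by rewrite /D oner_eq0 mulr1 Fa addrC.
have lt_e4' : e ^+ 4 + 1 <= Q.
  have -> : e = (nroots1 - 1)%N%:R by rewrite natrB ?nroots1_gt0.
  by rewrite -natrX natr1 ler_nat.
have e01 : e = 0 \/ 1 <= e.
  have -> : e = (nroots1 - 1)%N%:R by rewrite natrB ?nroots1_gt0.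
  by case: (nroots1 - 1)%N => [|n]; [left | right; rewrite ler1n].
move: sumD2 bD D2ge0 bF; rewrite D1; set S := \sum_l _; set T := \sum_v _ ^+ 2.
move: Q1 lt_e4' e01 e0; set q : rat := Q; set E : rat := e; clearbody q E S T.
clearbody kappa.
move=> Q1 lt_e4' e01 e0 DS bD S0 bF.
have {}bD : (q - 1) * (kappa - q) ^+ 2 <=
    (q - 1) * (E * q * (E ^+ 3 - kappa ^+ 2)).
  apply: le_trans bD _; rewrite DS.
  have -> : (q - 1) * (E * q * (E ^+ 3 - kappa ^+ 2)) =
     E * (E ^+ 2 * q * ((q - 1) * E) - kappa ^+ 2 * q * (q - 1)) by ring.
  by apply: ler_wpM2l => //; rewrite lerD2r.
rewrite ler_pM2l // in bD.
(* Here E^4 <= q - 1 is used. For E >= 1 the inequality contains q (kappa - 1)^2 + kappa^2 <= 0,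
   which is absurd; E = 0 is treated apart, with kappa = q. *)
have : E * kappa ^+ 2 * q + kappa ^+ 2 + q <= 2 * kappa * q by nra.
have q0 : 0 < q by lra.
case: e01 => [E0|E1].
  move: bD; rewrite E0 !mul0r => bD.
  have : (kappa - q) ^+ 2 = 0 by apply: le_anti; rewrite bD sqr_ge0.
  move/eqP; rewrite sqrf_eq0 subr_eq0 => /eqP Dk.
  move: S0; rewrite DS Dk; move: bF; rewrite E0 !mulr0 => T0.
  rewrite subr_ge0 => qT; have : 0 < q ^+ 2 * q * (q - 1) by rewrite !mulr_gt0 ?exprn_gt0.
  by rewrite ltNge (le_trans qT T0).
move=> H; have k0 := sqr_ge0 kappa.
have E1' : 0 <= (E - 1) * kappa ^+ 2 * q.
  by apply: mulr_ge0 (ltW q0); apply: mulr_ge0 k0; rewrite subr_ge0.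
have k1 : 0 <= q * (kappa - 1) ^+ 2 by rewrite mulr_ge0 ?sqr_ge0 // ltW.
have k00 : kappa ^+ 2 = 0 by lra.
by move/eqP: k00; rewrite sqrf_eq0 => /eqP k00; move: H; rewrite k00; lra.
Qed.

(** T plays the trace to a subfield with q elements, C the nonzero scalars and A the size of a
    fibre. Two averages are taken: over dilations l, and over the q - 1 scalar multiples of s, which
    turns Q - A = (q - 1) A into A. *)
Lemma level_set_bound (T : L -> L) (C : {set L}) (A q : nat) (s : L) :
    (forall x y, T (x - y) = T x - T y) ->
    (forall c v, c \in C -> T (c * v) = c * T v) ->
    0 \notin C -> #|C| = q.-1 -> (1 < q)%N -> #|L| = (q * A)%N ->
    #|[set l | T l == 0]| = A -> #|[set l | T l == s]| = A -> s != 0 ->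
  (#|[set x : L | T (x ^+ k) == s]|%:R - A%:R) ^+ 2 <= e ^+ 2 * A%:R.
Proof.
move=> TB TZ C0 cardC q_gt1 cardL kerT As nzs.
pose ind s l v : rat := (T (l * v) == s)%:R.
pose D s l := \sum_v dev v * ind s l v.
have T0 : T 0 = 0 by have := TB 0 0; rewrite !subrr.
have e0 : 0 <= e by rewrite subr_ge0 ler1n nroots1_gt0.
have Q1 := card_gt1.
have sum_ind z (z' : L) : z != 0 -> \sum_l ((T (l * z) == z')%:R : rat) =
    #|[set l | T l == z']|%:R.
  move=> nzz; under eq_bigr => l _ do rewrite mulrC.
  rewrite (sum_scale (fun l => (T l == z')%:R : rat) nzz).
  rewrite -sum1_card natr_sum [RHS]big_mkcond /=; apply: eq_bigr => l _.
  by rewrite inE; case: eqP.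
have DN : D s 1 = #|[set x : L | T (x ^+ k) == s]|%:R - A%:R.
  rewrite /D sum_dev_mul; congr (_ - _).
    rewrite -sum1_card natr_sum [RHS]big_mkcond /=; apply: eq_bigr => x _.
    by rewrite inE /ind mul1r; case: eqP.
  rewrite -As -(sum_ind 1 s (oner_neq0 _)); apply: eq_bigr => v _.
  by rewrite /ind mul1r mulr1.
have D0 : D s 0 = 0.
  by apply: big1 => v _; rewrite /ind mul0r T0 eq_sym (negPf nzs) mulr0.
have Dinv l y : y != 0 -> D s (l * y ^+ k) = D s l.
  move=> nzy; have nzyk : y ^+ k != 0 by rewrite expf_neq0.
  rewrite /D -[RHS](sum_scale _ nzyk); apply: eq_bigr => v _.
  by rewrite /ind mulrA [y ^+ k * v in RHS]mulrC dev_scale.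
have sumD : \sum_l D s l = 0.
  rewrite exchange_big /=.
  transitivity (\sum_v A%:R * dev v); last by rewrite -mulr_sumr sum_dev mulr0.
  apply: eq_bigr => v _; rewrite -mulr_sumr mulrC.
  have [->|nzv] := eqVneq v 0; first by rewrite dev0 !mulr0.
  by rewrite sum_ind // As.
have bD := invariant_bound D0 Dinv sumD.
pose E s' := \sum_l D s' l ^+ 2.
have EC c s' : c \in C -> E (c * s') = E s'.
  move=> cC; have nzc : c != 0 by apply: contraNneq C0 => <-.
  rewrite /E -[LHS](sum_scale _ nzc); apply: eq_bigr => l _.
  congr (_ ^+ 2); apply: eq_bigr => v _; congr (_ * _).
  by rewrite /ind -mulrA TZ // (inj_eq (mulfI nzc)).
(* Summing over all levels z leaves pairs v, w with T (l * (v - w)) = 0: every l if v = w, and A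
   values of l otherwise. As [dev] has zero sum, only the excess Q - A on the diagonal survives. *)
have sumE : \sum_z E z = (Q - A%:R) * ((Q - 1) * e).
  rewrite /E exchange_big /=.
  transitivity (\sum_v \sum_w dev v * dev w *
      \sum_l ((T (l * (v - w)) == 0)%:R : rat)).
    under [RHS]eq_bigr => v _ do under eq_bigr => w _ do rewrite mulr_sumr.
    under [RHS]eq_bigr => v _ do rewrite exchange_big /=.
    rewrite [RHS]exchange_big /=; apply: eq_bigr => l _.
    transitivity (\sum_z \sum_v \sum_w dev v * dev w * (ind z l v * ind z l w)).
      apply: eq_bigr => z _; rewrite /D expr2 mulr_suml; apply: eq_bigr => v _.
      by rewrite mulr_sumr; apply: eq_bigr => w _; rewrite mulrACA.
    rewrite exchange_big /=; apply: eq_bigr => v _.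
    rewrite exchange_big /=; apply: eq_bigr => w _; rewrite -mulr_sumr.
    congr (_ * _); rewrite (bigD1 (T (l * v))) //= /ind eqxx mul1r.
    rewrite big1 => [|z /negPf nz]; last by rewrite eq_sym nz mul0r.
    by rewrite addr0 mulrBr TB subr_eq0 eq_sym.
  transitivity (\sum_v (dev v ^+ 2 * (Q - A%:R) + dev v * A%:R * \sum_w dev w)).
    apply: eq_bigr => v _; rewrite mulr_sumr.
    rewrite (bigD1 v) //= [\sum_w dev v * _ * _](bigD1 v) //= addrA; congr (_ + _).
      have -> : \sum_l ((T (l * (v - v)) == 0)%:R : rat) = Q.
        under eq_bigr => l _ do rewrite subrr mulr0 T0 eqxx.
        by rewrite sumr_const -[LHS]mulr_natl mulr1.
      by ring.
    apply: eq_bigr => w ne_wv; rewrite sum_ind ?kerT; first by ring.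
    by rewrite subr_eq0 eq_sym.
  by rewrite sum_dev; under eq_bigr => v _ do rewrite mulr0 addr0;
     rewrite -mulr_suml sum_dev_sqr mulrC.
have E_ge0 z : 0 <= E z by apply: sumr_ge0 => l _; apply: sqr_ge0.
have bE : q.-1%:R * E s <= (Q - A%:R) * ((Q - 1) * e).
  rewrite -sumE -cardC mulr_natl -sumr_const.
  rewrite (eq_bigr (fun c => E (c * s))) => [|c cC]; last by rewrite EC.
  rewrite -(big_imset E) /=; last by move=> x y _ _; apply: mulIf.
  rewrite [leRHS](bigID (mem [set c * s | c in C])) /= lerDl.
  by apply: sumr_ge0.
have q1 : 0 < (q%:R - 1 : rat) by rewrite subr_gt0 ltr1n.
have {}bE : E s <= A%:R * ((Q - 1) * e).
  rewrite -(ler_pM2l q1) mulrA; move: bE.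
  have -> : q.-1%:R = q%:R - 1 :> rat by rewrite -{2}(ltn_predK q_gt1) -natr1 addrK.
  have -> : Q - A%:R = (q%:R - 1) * A%:R by rewrite cardL natrM mulrBl mul1r.
  by rewrite !mulrA.
rewrite -DN -(ler_pM2l Q1); apply: le_trans bD _.
apply: le_trans (ler_wpM2l e0 bE) _.
by rewrite le_eqVlt; apply/orP; left; apply/eqP; ring.
Qed.

End PowerFibres.

(** * Finite extensions and traces *)

Lemma card_finField_natr (F : finFieldType) : #|F|%:R = 0 :> F.
Proof.
have [p p_pr pcharFp] := finPcharP F; rewrite (card_pprimeChar pcharFp).
rewrite natrX pcharf0 // expr0n; case: logn (card_pprimeChar pcharFp) => // F1.
by have := finNzRing_gt1 F; rewrite F1.
Qed.

(** L is a splitting field of 'X^m - 'X. Its roots are the fixed points of the n-th power of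
    Frobenius, hence a subfield and all of L; they are m distinct elements because m = 0 in L makes
    the polynomial separable. *)
Lemma finField_extension (F : finFieldType) n : (0 < n)%N ->
  exists L : fieldExtType F, \dim {:L} = n.
Proof.
move=> n_gt0; pose m := (#|F| ^ n)%N.
have m_gt1: (m > 1)%N by rewrite (ltn_exp2l 0) ?finNzRing_gt1.
have m_gt0 := ltnW m_gt1; have m1_gt0: (m.-1 > 0)%N by rewrite -ltnS prednK.
pose q (R : nzRingType) : {poly R} := 'X^m - 'X.
have Dq R : q R = ('X^(m.-1) - 1) * ('X - 0).
  by rewrite subr0 mulrBl mul1r -exprSr prednK.
have /FinSplittingFieldFor[/= L splitLq]: q F != 0.
  by rewrite Dq monic_neq0 ?rpredM ?monicXsubC ?monicXnsubC.
rewrite rmorphB rmorphXn /= map_polyX -/(q L) in splitLq.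
exists L; pose Fm := FinFieldExtType L.
have /finField_galois_generator[/= a _ Da]: (1 <= {:L})%VS by apply: sub1v.
pose Em := fixedSpace (a ^+ n)%g; rewrite dimv1 expn1 in Da.
have{splitLq} [zs DqL defL] := splitLq.
have m0 : m%:R = 0 :> L.
  rewrite natrX -(rmorph_nat (in_alg L)) card_finField_natr rmorph0 expr0n.
  by rewrite gtn_eqF.
have Uzs: uniq zs.
  rewrite -separable_prod_XsubC -(eqp_separable DqL) Dq separable_root andbC.
  rewrite /root !hornerE subr_eq0 eq_sym expr0n gtn_eqF ?oner_eq0 //=.
  rewrite separable_Xn_sub_1 // -subn1 natrB // subr_eq0.
  by rewrite m0 eq_sym oner_eq0.
suffices /eq_card cardL: Fm =i zs.
  have : #|Fm| = m.
    rewrite cardL; apply: succn_inj; rewrite (card_uniqP _) //=.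
    rewrite -(size_prod_XsubC _ id) -(eqp_size DqL) size_polyDl size_polyXn //.
    by rewrite size_polyN size_polyX.
  have := card_vspace (fullv : {vspace finvect_type L}); rewrite card_vspacef => -> /eqP.
  by rewrite eqn_exp2l ?finNzRing_gt1 // => /eqP.
have in_zs: zs =i Em.
  move=> z; rewrite -root_prod_XsubC -(eqp_root DqL) (sameP fixedSpaceP eqP).
  rewrite /root !hornerE subr_eq0 /= /m; congr (_ == z).
  elim: (n) => [|i IHi]; first by rewrite gal_id.
  by rewrite expgSr expnSr exprM IHi galM ?Da ?memvf.
suffices defEm: Em = {:L}%VS by move=> z; rewrite in_zs defEm memvf.
apply/eqP; rewrite eqEsubv subvf -defL -[Em]subfield_closed agenvS //.
by rewrite subv_add sub1v; apply/span_subvP=> z; rewrite in_zs.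
Qed.

Section Extension.
Variables (F : finFieldType) (L0 : fieldExtType F).
Local Notation L := (finvect_type L0).
Local Notation n := (\dim {:L0}).
Local Notation q := #|F|.

Lemma card_ext : #|L| = (q ^ n)%N.
Proof. by have := card_vspace (fullv : {vspace L}); rewrite card_vspacef. Qed.

Lemma expq_in_alg (c : F) i : (c%:A : L) ^+ (q ^ i) = c%:A.
Proof.
elim: i => [|i IHi]; first by rewrite expr1.
by rewrite expnSr exprM IHi -in_algE -rmorphXn expf_card.
Qed.

Lemma expqB i (x y : L) : (x - y) ^+ (q ^ i) = x ^+ (q ^ i) - y ^+ (q ^ i).
Proof.
have [p _ pcharFp] := finPcharP F.
have pL : p \in [pchar L] by rewrite pchar_lalg.
rewrite (card_pprimeChar pcharFp) -expnM; elim: (_ * _)%N => [|j IHj] //.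
by rewrite expnSr !exprM IHj -!(pFrobenius_autE pL) rmorphB.
Qed.

Lemma expqD i (x y : L) : (x + y) ^+ (q ^ i) = x ^+ (q ^ i) + y ^+ (q ^ i).
Proof.
have E : (- y) ^+ (q ^ i) = - y ^+ (q ^ i).
  have := expqB i 0 y; rewrite sub0r expr0n expn_eq0.
  by rewrite gtn_eqF ?sub0r // ltnW ?finNzRing_gt1.
by rewrite -{1}[y]opprK expqB E opprK.
Qed.

(** The field trace, kept with values in L so that it is a polynomial function and its level sets
    are sets of roots. *)
Definition Tr (x : L) : L := \sum_(i < n) x ^+ (q ^ i).

Lemma TrB x y : Tr (x - y) = Tr x - Tr y.
Proof. by rewrite -sumrB; apply: eq_bigr => i _; rewrite expqB. Qed.

Lemma TrZ (c : F) x : Tr (c%:A * x) = c%:A * Tr x.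
Proof. by rewrite mulr_sumr; apply: eq_bigr => i _; rewrite exprMn expq_in_alg. Qed.

Lemma expq_fix (x : L) : x ^+ q = x -> exists c : F, x = c%:A.
Proof.
move=> xq; have : x \in 1%AS by rewrite Fermat's_little_theorem dimv1 expn1 xq.
by case/vlineP => c ->; exists c.
Qed.

(** Raising to the power q permutes the conjugates cyclically, as x^(q^n) = x. *)
Lemma Tr_in_F x : exists c : F, Tr x = c%:A.
Proof.
apply: expq_fix; have n_gt0 : (0 < n)%N by rewrite adim_gt0.
have expq_sum (I : finType) (f : I -> L) : (\sum_i f i) ^+ q = \sum_i f i ^+ q.
  have expq0 : (0 : L) ^+ q = 0 by rewrite expr0n gtn_eqF // ltnW ?finNzRing_gt1.
  apply: (big_morph (fun x => x ^+ q) _ expq0) => y z.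
  by have := expqD 1 y z; rewrite !expn1.
rewrite /Tr expq_sum; case: n n_gt0 card_ext => // m _ cardL.
rewrite big_ord_recr [RHS]big_ord_recl /= -exprM -expnSr -cardL expf_card addrC.
rewrite expn0 expr1; congr (_ + _).
by apply: eq_bigr => i _; rewrite -exprM -expnSr.
Qed.

Lemma card_roots_le (p : {poly L}) m : p != 0 -> (size p <= m.+1)%N ->
  (#|[set x | root p x]| <= m)%N.
Proof.
move=> nzp szp; rewrite cardE -ltnS; apply: leq_trans szp.
rewrite max_poly_roots ?enum_uniq //; apply/allP => x.
by rewrite mem_enum inE.
Qed.

Local Notation "p ^%:A" := (map_poly (in_alg L) p) (at level 2, format "p ^%:A").

Lemma dim_gt0 : (0 < n)%N. Proof. by rewrite adim_gt0. Qed.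

Definition Frob_sum m : {poly L} := \sum_(i < m) 'X^(q ^ i).

Lemma hornerFrob_sum m x : (Frob_sum m).[x] = \sum_(i < m) x ^+ (q ^ i).
Proof. by rewrite horner_sum; apply: eq_bigr => i _; rewrite hornerXn. Qed.

Lemma size_Frob_sum m : (size (Frob_sum m) <= (q ^ m.-1).+1)%N.
Proof.
apply: leq_trans (size_sum _ _ _) _; apply/bigmax_leqP => i _.
by rewrite size_polyXn ltnS leq_exp2l ?finNzRing_gt1 //; case: m i => [[]|m i] //=;
   rewrite -ltnS.
Qed.

Lemma coef1_Frob_sum m : (0 < m)%N -> (Frob_sum m)`_1 = 1.
Proof.
case: m => // m _; rewrite /Frob_sum coef_sum big_ord_recl /= coefXn expn0 eqxx.
rewrite big1 ?addr0 // => i _; rewrite coefXn ltn_eqF //.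
by rewrite -{1}(expn0 q) ltn_exp2l ?finNzRing_gt1.
Qed.

Lemma card_Frob_level_le m (a s : L) : (0 < m)%N -> (a != 0) || (s != 0) ->
  (#|[set u : L | (a * (\sum_(i < m) u ^+ (q ^ i)) == s)%R]| <= q ^ m.-1)%N.
Proof.
move=> m_gt0 nz; pose p := a *: Frob_sum m - s%:P.
have -> : #|[set u : L | a * (\sum_(i < m) u ^+ (q ^ i)) == s]| =
    #|[set u | root p u]|.
  apply: eq_card => u; rewrite !inE /root !hornerE hornerFrob_sum.
  by rewrite subr_eq0.
apply: card_roots_le.
  apply: contraTneq nz => p0; rewrite negb_or !negbK; apply/andP.
  have a0 : a = 0.
    have := congr1 (fun p : {poly L} => p`_1) p0.
    by rewrite coefB coefZ coef1_Frob_sum // coefC coef0 subr0 mulr1.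
  by move: p0; rewrite /p a0 scale0r sub0r eqxx => /eqP; rewrite oppr_eq0 polyC_eq0.
apply: leq_trans (size_polyD _ _) _; rewrite geq_max size_polyN size_polyC.
rewrite (leq_trans (size_scale_leq _ _)) ?size_Frob_sum //.
by apply: leq_trans (leq_b1 _) _.
Qed.

(** The q levels share q^n elements and none exceeds q^(n-1), so all reach this bound. *)
Lemma card_Tr_level (c : F) : #|[set x | Tr x == c%:A]| = (q ^ n.-1)%N.
Proof.
have le_level s : (#|[set x | (Tr x == s)%R]| <= q ^ n.-1)%N.
  have := @card_Frob_level_le n 1 s dim_gt0; rewrite oner_eq0 => /(_ isT).
  by congr (_ <= _)%N; apply: eq_card => x; rewrite !inE mul1r.
have sum_level : (\sum_(c : F) #|[set x | (Tr x == c%:A)%R]| = q * q ^ n.-1)%N.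
  rewrite -expnS prednK ?dim_gt0 // -card_ext -sum1_card.
  have cP x : exists c : F, Tr x == c%:A by have [c' ->] := Tr_in_F x; exists c'.
  rewrite [RHS](partition_big (fun x => xchoose (cP x)) xpredT) //=.
  apply: eq_bigr => b _; rewrite -sum1_card; apply: eq_bigl => x; rewrite inE.
  apply/eqP/eqP => [Tx|<-]; last exact/eqP/(xchooseP (cP x)).
  have /eqP := xchooseP (cP x); rewrite {1}Tx => /eqP; rewrite -subr_eq0 -scalerBl.
  by rewrite scaler_eq0 oner_eq0 orbF subr_eq0 eq_sym => /eqP.
apply/eqP; rewrite eqn_leq le_level /= leqNgt; apply/negP => lt_c.
have := sum_level; rewrite (bigD1 c) //= => Dsum.
have : (\sum_(i | i != c) #|[set x | (Tr x == i%:A)%R]| <= #|F|.-1 * q ^ n.-1)%N.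
  apply: (@leq_trans (\sum_(i : F | i != c) q ^ n.-1)%N).
    by apply: leq_sum => i _; apply: le_level.
  by rewrite sum_nat_const cardC1.
have q_gt0 : (0 < q)%N by rewrite ltnW ?finNzRing_gt1.
move=> le_sum; have : (q * q ^ n.-1 < q ^ n.-1 + q.-1 * q ^ n.-1)%N.
  by rewrite -Dsum -addSn leq_add.
by rewrite -mulSn prednK // ltnn.
Qed.

Definition generates (u : L) := (<<1; u>>%VS == {:L}%VS).

Lemma expq_horner i (p : {poly F}) (u : L) :
  (p^%:A).[u ^+ (q ^ i)] = (p^%:A).[u] ^+ (q ^ i).
Proof.
elim/poly_ind: p => [|p c IHp].
  by rewrite rmorph0 !horner0 expr0n expn_eq0 gtn_eqF // ltnW ?finNzRing_gt1.
rewrite rmorphD rmorphM /= map_polyX map_polyC !hornerE IHp expqD exprMn.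
by rewrite expq_in_alg.
Qed.

(** All of L consists of polynomials in u, so a coincidence of conjugates of u would make the two
    Frobenius powers agree on L; their difference has too small a degree for that. *)
Lemma generates_inj u i j : generates u -> (i < n)%N -> (j < n)%N ->
  u ^+ (q ^ i) = u ^+ (q ^ j) -> i = j.
Proof.
move=> /eqP gen_u; wlog lt_ij : i j / (i < j)%N => [IH lt_i lt_j Du|].
  have [ij|ji|//] := ltngtP i j; first exact: IH ij lt_i lt_j Du.
  by apply/esym; apply: IH ji lt_j lt_i (esym Du).
move=> _ lt_jn Du.
pose p : {poly L} := 'X^(q ^ j) - 'X^(q ^ i).
have lt_q : (q ^ i < q ^ j)%N by rewrite ltn_exp2l ?finNzRing_gt1.
have szp : size p = (q ^ j).+1 by rewrite size_polyDl ?size_polyN !size_polyXn.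
have nzp : p != 0 by rewrite -size_poly_eq0 szp.
have := card_roots_le nzp (eq_leq szp).
suffices -> : [set x | root p x] = setT.
  by rewrite cardsT card_ext leq_exp2l ?finNzRing_gt1 // leqNgt lt_jn.
apply/setP => x; rewrite !inE /root !hornerE subr_eq0.
have /Fadjoin1_polyP [h ->] : x \in <<1; u>>%VS by rewrite gen_u memvf.
by rewrite -!expq_horner Du eqxx.
Qed.

Lemma generator_poly (u : L) : generates u -> exists f : {poly F},
  [/\ f \is monic, size f = n.+1, (- f`_n.-1)%:A = Tr u,
      (forall p : {poly F}, (f %| p) = root p^%:A u) &
      (forall x : L, exists h : {poly F}, x = (h^%:A).[u])].
Proof.
move=> gen_u; have /polyOver1P [f Df] := minPolyOver 1 u.
have szf : size f = n.+1.
  rewrite -(size_map_poly (in_alg L)) -Df size_minPoly; congr _.+1.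
  by rewrite adjoin_degreeE (eqP gen_u) dimv1 divn1.
have f_mon : f \is monic by rewrite -(map_monic (in_alg L)) -Df monic_minPoly.
have dvdf p : (f %| p) = root p^%:A u.
  rewrite -(dvdp_map (in_alg L)) -Df; apply/idP/idP => [dv_p|].
    exact: root_dvdp dv_p (root_minPoly _ _).
  by apply: minPoly_dvdp; apply: alg_polyOver.
exists f; split=> // [|x]; last first.
  by apply/Fadjoin1_polyP; rewrite (eqP gen_u) memvf.
pose rs := [seq u ^+ (q ^ i) | i <- iota 0 n].
have szrs : size rs = n by rewrite size_map size_iota.
have rsP : all (root f^%:A) rs.
  apply/allP => _ /mapP [i _ ->]; rewrite /root expq_horner.
  have /rootP -> : root f^%:A u by rewrite -dvdf.
  by rewrite expr0n expn_eq0 gtn_eqF // ltnW ?finNzRing_gt1.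
have Urs : uniq_roots rs.
  rewrite uniq_rootsE map_inj_in_uniq ?iota_uniq // => i j.
  by rewrite !mem_iota !add0n; apply: generates_inj.
have szfA : size f^%:A = (size rs).+1 by rewrite size_map_poly szf szrs.
have Dp := all_roots_prod_XsubC szfA rsP Urs.
rewrite lead_coef_map (monicP f_mon) rmorph1 scale1r in Dp.
rewrite scaleNr -in_algE -(coef_map (in_alg L)) Dp.
have := @coefPn_prod_XsubC L rs; rewrite szrs => -> //; last first.
  by rewrite -lt0n dim_gt0.
rewrite opprK big_map /Tr -(big_mkord xpredT (fun i => u ^+ (q ^ i))).
by rewrite /index_iota subn0.
Qed.
End Extension.

(** S bounds the elements of given nonzero trace in proper subfields, and [e.+1] is the number of
    roots of unity. The case [e.+1 = q] must be excluded: for q = 3, e = 2 and n = 3 or 4 the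
    conclusion fails. *)
Lemma trace_count_ineq (q n e S : nat) :
    (2 < q)%N -> (2 < n)%N -> (e ^ 4 < q ^ n)%N -> e.+1 != q ->
    (q.-1 * S = (q ^ n./2).-1)%N ->
  (e ^ 2 + 2 * (e.+1 * S) < q ^ n.-1)%N.
Proof.
move=> q_gt2 n_gt2 lt_e ne_eq DS.
have q_gt0 : (0 < q)%N by apply: leq_trans q_gt2.
have [h Dh] : exists h, n = (odd n + h.*2)%N by exists n./2; rewrite odd_double_half.
have hn : n./2 = h by rewrite Dh half_bit_double.
rewrite hn in DS; have y_gt0 : (0 < q ^ h)%N by rewrite expn_gt0 q_gt0.
have leS : (2 * S <= (q ^ h).-1)%N by rewrite -DS leq_mul2r; apply/orP; right; lia.
case: (odd n) Dh => Dh; last first.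
  have h_gt1 : (1 < h)%N by lia.
  pose z := (q ^ h.-1)%N.
  have Dy : (q ^ h = q * z)%N by rewrite /z -expnS prednK // ltnW.
  have -> : (q ^ n.-1 = q * z * z)%N.
    by rewrite -Dy /z -expnD Dh; congr (_ ^ _)%N; lia.
  have e2 : (e ^ 2 < q * z)%N.
    by rewrite -Dy -(ltn_exp2r _ _ (isT : (0 < 2)%N)) -!expnM (_ : h * 2 = n)%N //; lia.
  rewrite Dy in leS.
  have le_z : (e + 2 <= z)%N.
    have [h2|h3] : h = 2 \/ (2 < h)%N by lia.
      move: e2; rewrite /z h2 /= expn1 => e2.
      have : (e < q)%N by rewrite -(ltn_exp2r _ _ (isT : (0 < 2)%N)) -mulnn.
      by move: ne_eq => /eqP; lia.
    have : (q * q <= z)%N by rewrite mulnn /z leq_exp2l //; lia.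
    rewrite leqNgt => zq; apply/negP => lt_z; move: zq => /negP; apply.
    nia.
  nia.
have {}Dh : n = h.*2.+1 by rewrite Dh.
have -> : (q ^ n.-1 = q ^ h * q ^ h)%N by rewrite -expnD Dh addnn.
have {}lt_e : (e ^ 4 < q * (q ^ h * q ^ h))%N.
  by rewrite -expnD -expnS addnn -Dh.
have [h1|h_gt1] : h = 1%N \/ (1 < h)%N by lia.
  move: DS lt_e; rewrite h1 expn1 => DS lt_e.
  have S1 : S = 1%N by nia.
  have : (e < q)%N.
    rewrite ltnNge; apply/negP => le_qe; move: lt_e; rewrite ltnNge => /negP; apply.
    by rewrite mulnn -expnS; apply: leq_trans (_ : q ^ 4 <= _)%N; rewrite ?leq_pexp2l ?leq_exp2r.
  by move: ne_eq => /eqP; nia.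
have : (q * q <= q ^ h)%N by rewrite mulnn leq_exp2l // ltnW.
move: (q ^ h)%N leS lt_e => y leS lt_e le_qy.
have lt_ey : (2 * e < y)%N.
  rewrite -(ltn_exp2r _ _ (isT : (0 < 4)%N)) expnMn.
  apply: (@leq_trans (16 * (q * (y * y)))); first by rewrite ltn_pmul2l.
  have : (16 * q <= y * y)%N by nia.
  by rewrite (_ : 4 = 2 + 2)%N // expnD -!mulnn mulnA leq_mul2r => ->; rewrite orbT.
nia.
Qed.

(** * Counting k-th roots in a finite field *)

Section RootCounts.
Variables (L : finFieldType) (k : nat).
Hypothesis k_gt0 : (0 < k)%N.

Lemma nroots_le (v : L) : (nroots k v <= nroots1 L k)%N.
Proof.
have [->|nzv] := eqVneq v 0; first by rewrite nroots0 // nroots1_gt0.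
have [E|[x]] := set_0Vmem [set x : L | x ^+ k == v].
  by rewrite /nroots E cards0.
rewrite inE => /eqP Dv; rewrite -Dv nroots_pow //.
by apply: contraNneq nzv => x0; rewrite -Dv x0 expr0n gtn_eqF.
Qed.

Lemma card_power_preim (U : {set L}) :
  (#|[set x : L | x ^+ k \in U]| <= nroots1 L k * #|U|)%N.
Proof.
have -> : #|[set x : L | (x ^+ k)%R \in U]| = (\sum_(v in U) nroots k v)%N.
  rewrite -sum1_card (partition_big (fun x => x ^+ k) (mem U)) => [|x]; last first.
    by rewrite inE.
  apply: eq_bigr => v vU; rewrite /nroots -sum1_card; apply: eq_bigl => x.
  by rewrite !inE andb_idl // => /eqP ->.
rewrite mulnC -sum_nat_const; apply: leq_sum => v _; exact: nroots_le.
Qed.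

(** The nonempty fibres of the k-th power map on nonzero elements all have this size. *)
Lemma nroots1_dvdn : (nroots1 L k %| #|L|.-1)%N.
Proof.
have -> : #|L|.-1 = (\sum_(v : L | (v != 0)%R) nroots k v)%N.
  rewrite -(cardC1 (0 : L)) -sum1_card.
  rewrite (partition_big (fun x => x ^+ k) (predC1 0)) => [|x]; last first.
    by rewrite !inE expf_eq0 negb_and => ->; rewrite orbT.
  apply: eq_bigr => v nzv; rewrite /nroots -sum1_card; apply: eq_bigl => x.
  rewrite !inE andb_idl // => /eqP xv; apply: contraNneq nzv => x0.
  by rewrite -xv x0 expr0n gtn_eqF.
apply: dvdn_sum => v nzv; have [E|[x]] := set_0Vmem [set x : L | x ^+ k == v].
  by rewrite /nroots E cards0 dvdn0.
rewrite inE => /eqP Dv; rewrite -Dv nroots_pow ?dvdnn //.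
by apply: contraNneq nzv => x0; rewrite -Dv x0 expr0n gtn_eqF.
Qed.

Lemma nroots1_leq : (nroots1 L k <= k)%N.
Proof.
rewrite /nroots1 cardE -ltnS; have szp : size ('X^k - 1 : {poly L}) = k.+1.
  by rewrite size_XnsubC.
rewrite -szp max_poly_roots ?enum_uniq -?size_poly_eq0 ?szp //.
by apply/allP => x; rewrite mem_enum inE /root !hornerE subr_eq0.
Qed.

End RootCounts.

Lemma finField_prim_root (L : finFieldType) :
  exists z : L, #|L|.-1.-primitive_root z.
Proof.
have L1_gt0 : (0 < #|L|.-1)%N by rewrite -subn1 subn_gt0 finNzRing_gt1.
have : has #|L|.-1.-primitive_root (enum (predC1 (0 : L))).
  apply: has_prim_root; rewrite ?enum_uniq // -?cardE ?cardC1 //.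
  apply/allP => x; rewrite mem_enum unity_rootE !inE => nzx.
  apply/eqP/(mulfI nzx); rewrite -exprS prednK ?expf_card ?mulr1 //.
  by rewrite ltnW ?finNzRing_gt1.
by case/hasP => z _ zP; exists z.
Qed.

(** * Generating k-th powers with prescribed trace *)

Section Generation.
Variables (F : finFieldType) (L0 : fieldExtType F).
Local Notation L := (finvect_type L0).
Local Notation n := (\dim {:L0}).
Local Notation q := #|F|.

Lemma not_generates (u : L) : ~~ generates u ->
  exists m, [/\ (0 < m)%N, (m < n)%N, (m %| n)%N & u ^+ (q ^ m) = u].
Proof.
move=> ngen; exists (\dim <<1; u>>); split.
- by rewrite adim_gt0.
- rewrite ltn_neqAle dimvS ?subvf // andbT; apply: contra ngen => /eqP Ddim.
  by rewrite /generates eqEdim subvf Ddim leqnn.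
- by apply: field_dimS; apply: subvf.
by apply/eqP; rewrite -Fermat's_little_theorem memv_adjoin.
Qed.

(** A primitive element z works: if z^k lay in a proper subfield with q^m elements, q^n - 1 would
    divide k (q^m - 1), so k > q^(n-m) with 2m <= n. *)
Lemma exists_generating_power k : (0 < k)%N -> ((k - 1) ^ 2 < q ^ n)%N ->
  exists y : L, generates (y ^+ k).
Proof.
move=> k_gt0 lt_k; have [z zP] := finField_prim_root L.
exists z; apply: contraLR lt_k => /not_generates [m [m_gt0 lt_mn dv_mn]].
have q_gt1 := finNzRing_gt1 F; have q_gt0 := ltnW q_gt1.
have qm_gt1 : (1 < q ^ m)%N by rewrite -{1}(expn0 q) ltn_exp2l.
have nzz : z != 0.
  apply/eqP=> z0; have := prim_expr_order zP.
  by rewrite z0 expr0n (gtn_eqF (prim_order_gt0 zP)) => /eqP; rewrite eq_sym oner_eq0.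
rewrite -exprM => Dz; have : z ^+ (k * (q ^ m).-1) == 1.
  apply/eqP/(mulfI (expf_neq0 k nzz)).
  by rewrite mulr1 -exprD -[X in (X + _)%N]muln1 -mulnDr add1n prednK // ltnW.
rewrite -(prim_order_dvd zP) card_ext => /dvdn_leq.
rewrite muln_gt0 k_gt0 -ltnS prednK ?(ltnW qm_gt1) // => /(_ qm_gt1).
have le_2m : (2 * m <= n)%N.
  case/dvdnP: dv_mn lt_mn => [[|[|c]] ->]; rewrite ?mul0n ?mul1n ?ltnn //.
  by move=> _; rewrite leq_mul2r orbC.
have Dn : (q ^ n = q ^ m * q ^ (n - m))%N by rewrite -expnD subnKC // ltnW.
have le_q : (q ^ m <= q ^ (n - m))%N by rewrite leq_exp2l //; lia.
rewrite -leqNgt => le_k.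
apply: (@leq_trans ((q ^ (n - m)) ^ 2)).
  by rewrite -expnM leq_exp2l //; lia.
rewrite leq_exp2r //; move: le_k; rewrite Dn.
nia.
Qed.

Lemma card_power_trace_bound k (s : F) : (0 < k)%N -> s != 0 ->
  (#|[set x : L | Tr (x ^+ k) == s%:A]|%:R - (q ^ n.-1)%:R) ^+ 2 <=
    ((nroots1 L k)%:R - 1) ^+ 2 * (q ^ n.-1)%:R :> rat.
Proof.
move=> k_gt0 nzs; have nzsA : s%:A != 0 :> L.
  by rewrite scaler_eq0 (negPf nzs) oner_eq0.
pose C := [set (c%:A : L) | c in predC1 (0 : F)].
have C0 : 0 \notin C.
  by apply/imsetP => [[c nzc /esym/eqP]]; rewrite scaler_eq0 oner_eq0 orbF; apply/negP.
have cardC : #|C| = q.-1.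
  rewrite card_imset ?cardC1 // => x y /eqP.
  by rewrite -subr_eq0 -scalerBl scaler_eq0 oner_eq0 orbF subr_eq0 => /eqP.
have TZ c v : c \in C -> Tr (c * v) = c * Tr v :> L.
  by case/imsetP => b _ ->; apply: TrZ.
have cardL' : #|L| = (q * q ^ n.-1)%N by rewrite card_ext -expnS prednK ?dim_gt0.
have kerT : #|[set l : L | Tr l == 0]| = (q ^ n.-1)%N.
  by rewrite -(card_Tr_level L0 0) scale0r.
have := level_set_bound k_gt0 (@TrB F L0) TZ C0 cardC (finNzRing_gt1 F) cardL' kerT
  (card_Tr_level L0 s) nzsA.
by [].
Qed.

(** Otherwise the N elements x with k-th power of trace s all have x^k in proper subfields, so N <=
    d S. With A = q^(n-1), the bound (N - A)^2 <= (d - 1)^2 A yields A <= (d - 1)^2 + 2N, against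
    [trace_count_ineq]. *)
Lemma exists_power_trace k (s : F) :
    (0 < k)%N -> (2 < q)%N -> (2 < n)%N -> ((k - 1) ^ 4 < q ^ n)%N -> s != 0 ->
  exists2 x : L, generates (x ^+ k) & Tr (x ^+ k) = s%:A.
Proof.
move=> k_gt0 q_gt2 n_gt2 lt_k nzs.
pose X := [set x : L | Tr (x ^+ k) == s%:A].
have [/existsP [x /andP [gx /eqP Tx]] | /existsPn no_gen] :=
  boolP [exists x : L, generates (x ^+ k) && (Tr (x ^+ k) == s%:A)].
  by exists x.
(* For m dividing n, Tr restricts to the subfield with q^m elements as n / m times its own trace.
   The factor n / m may vanish in F; then s != 0 makes the level empty. *)
pose U (m : nat) := [set u : L | (n %/ m)%:R * (\sum_(i < m) u ^+ (q ^ i)) == s%:A].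
have nzsA : s%:A != 0 :> L by rewrite scaler_eq0 (negPf nzs) oner_eq0.
have q_gt1 := finNzRing_gt1 F.
pose d := nroots1 L k.
have subX : X \subset \bigcup_(i < n./2) [set x : L | x ^+ k \in U i.+1].
  apply/subsetP => x; rewrite inE => /eqP Tx.
  have := no_gen x; rewrite Tx eqxx andbT => /not_generates [m [m_gt0 lt_mn dv_mn Du]].
  have lt_m : (m.-1 < n./2)%N.
    case/dvdnP: dv_mn lt_mn => [[|[|c]] ->]; rewrite ?mul0n ?mul1n ?ltnn // => _.
    by rewrite prednK // geq_half_double -muln2 mulnC leq_mul2r orbC.
  apply/bigcupP; exists (Ordinal lt_m) => //; rewrite !inE /= prednK // -Tx.
  suffices -> c : c%:R * (\sum_(i < m) (x ^+ k) ^+ (q ^ i)) =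
      \sum_(i < c * m) (x ^+ k) ^+ (q ^ i) by rewrite divnK.
  elim: c => [|c IHc]; first by rewrite mul0r mul0n big_ord0.
  rewrite mulSn addnC big_split_ord /= -IHc -natr1 mulrDl mul1r; congr (_ + _).
  apply: eq_bigr => i _; rewrite expnD exprM; congr (_ ^+ _).
  elim: c {IHc} => [|c IHc]; first by rewrite mul0n expr1.
  by rewrite mulSn expnD exprM Du.
pose S := (\sum_(i < n./2) q ^ i)%N.
have leX : (#|X| <= d * S)%N.
  apply: leq_trans (subset_leq_card subX) _.
  rewrite /S big_distrr /=.
  apply: (big_ind2 (fun (A : {set L}) s => (#|A| <= s)%N)) => [|A a B b leA leB|i _].
  - by rewrite cards0.
  - by apply: leq_trans (leq_card_setU A B).1 (leq_add leA leB).
  apply: leq_trans (card_power_preim k_gt0 _) _; rewrite leq_mul2l; apply/orP; right.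
  by apply: (@card_Frob_level_le F L0 i.+1) => //; rewrite nzsA orbT.
have cardL := card_ext L0; have n_gt0 := dim_gt0 L0; have q_gt0 := ltnW q_gt1.
have d_gt0 : (0 < d)%N := nroots1_gt0 L k.
have lt_d : ((d - 1) ^ 4 < q ^ n)%N.
  apply: leq_ltn_trans lt_k; rewrite leq_exp2r // leq_sub2r //.
  exact: nroots1_leq.
(* d divides q^n - 1, which is prime to q. *)
have ne_dq : (d - 1).+1 != q.
  rewrite subn1 prednK //; apply: contraTneq (nroots1_dvdn L k_gt0) => Dd.
  rewrite -/d Dd cardL -(prednK n_gt0) expnS; set A := (q ^ _)%N.
  have A_gt0 : (0 < A)%N by rewrite expn_gt0 q_gt0.
  apply/negP => dv; have : (q %| 1)%N.
    rewrite -(dvdn_addr 1 dv) addn1 prednK ?muln_gt0 ?q_gt0 //.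
    exact: dvdn_mulr.
  by rewrite dvdn1 => /eqP q1; rewrite q1 in q_gt1.
have DS : (q.-1 * S = (q ^ n./2).-1)%N by rewrite /S predn_exp.
have := trace_count_ineq q_gt2 n_gt2 lt_d ne_dq DS.
rewrite subn1 prednK // => ineq.
have := card_power_trace_bound k_gt0 nzs.
rewrite -/X -/d; set A : rat := (_ ^ _)%:R; set N : rat := _%:R.
have {}ineq : (d%:R - 1) ^+ 2 + 2 * N + 1 <= A :> rat.
  apply: (@le_trans _ _ (((d - 1) ^ 2 + 2 * (d * S)).+1%:R)); last by rewrite ler_nat subn1.
  rewrite -[leRHS]natr1 natrD natrX natrB // natrM lerD2r lerD2l ler_wpM2l //.
  by rewrite ler_nat.
have N_ge0 : 0 <= N by apply: ler0n.
move: ineq; set E := (_ - 1) ^+ 2; have : 0 <= E by apply: sqr_ge0.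
clearbody E A N => E0 ineq bound; have N0 := N_ge0.
exfalso; have A0 : 0 < A by lra.
have : 0 <= A * (A - 2 * N - 1 - E) by apply: mulr_ge0; lra.
have : 0 <= N ^+ 2 by apply: sqr_ge0.
lra.
Qed.
End Generation.

(** * Polynomials whose companion matrix is a k-th power *)

Section PowerRoots.
Variables (F : fieldType) (k : nat).

Definition has_power_root (f : {poly F}) := exists h : {poly F}, f %| h ^+ k - 'X.

Lemma power_of_char_poly m (B : 'M[F]_m.+1) :
  has_power_root (char_poly B) -> exists X : 'M[F]_m.+1, B = X ^+ k.
Proof.
case=> h /dvdpP [p Dp]; exists (horner_mx B h).
apply/eqP; rewrite eq_sym -subr_eq0 -rmorphXn -[X in _ - X]horner_mx_X -rmorphB.
by rewrite Dp rmorphM /= Cayley_Hamilton mulr0.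
Qed.

Lemma has_power_root_XsubC b : has_power_root ('X - (b ^+ k)%:P).
Proof. by exists b%:P; rewrite -dvdpNr opprB polyC_exp. Qed.

(** Chinese remainders: the new root is congruent to [hf] modulo f and to [hg] modulo g. *)
Lemma has_power_root_mul f g : coprimep f g ->
  has_power_root f -> has_power_root g -> has_power_root (f * g).
Proof.
move=> cofg [hf Df] [hg Dg]; have /Bezout_eq1_coprimepP [[u v] /= Duv] := cofg.
exists (hg * (u * f) + hf * (v * g)); rewrite Gauss_dvdp //; apply/andP; split.
  rewrite -(subrK (hf ^+ k) (_ ^+ k)) -addrA dvdp_addr // subrXX dvdp_mulr //.
  have -> : hg * (u * f) + hf * (v * g) - hf = (hg - hf) * u * f.
    by rewrite -[X in _ - X]mulr1 -Duv; ring.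
  exact: dvdp_mulIr.
rewrite -(subrK (hg ^+ k) (_ ^+ k)) -addrA dvdp_addr // subrXX dvdp_mulr //.
have -> : hg * (u * f) + hf * (v * g) - hg = (hf - hg) * v * g.
  by rewrite -[X in _ - X]mulr1 -Duv; ring.
exact: dvdp_mulIr.
Qed.

Lemma has_power_root_XsubC_pair a b : a ^+ k != b ^+ k ->
  has_power_root (('X - (a ^+ k)%:P) * ('X - (b ^+ k)%:P)).
Proof.
move=> ne_ab; apply: has_power_root_mul; try exact: has_power_root_XsubC.
by rewrite coprimep_XsubC root_XsubC eq_sym.
Qed.

(** A Hensel step: modulo Y^2 the k-th power of b + aY is b^k + k b^(k-1) a Y, and a is chosen to
    make the coefficient of Y equal to 1. *)
Lemma has_power_root_XsubC_sqr b : k%:R != 0 :> F -> b != 0 ->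
  has_power_root (('X - (b ^+ k)%:P) * ('X - (b ^+ k)%:P)).
Proof.
move=> nzk nzb; set Y := 'X - _.
have expand (a : F) j : exists r : {poly F},
    (b%:P + a%:P * Y) ^+ j.+1 = (b ^+ j.+1)%:P + (j.+1%:R * b ^+ j * a)%:P * Y + r * (Y * Y).
  elim: j => [|j [r IHj]]; first by exists 0; rewrite !expr1 expr0 !mul1r mul0r addr0.
  exists ((j.+1%:R * b ^+ j * a * a)%:P + r * (b%:P + a%:P * Y)).
  rewrite exprS IHj -[j.+2%:R]natr1 [b ^+ j.+2]exprS [b ^+ j.+1]exprS.
  by rewrite !(polyCM, polyCD) polyC1; ring.
rewrite /has_power_root; case: k nzk @Y expand => [|j] nzk Y expand; first by rewrite eqxx in nzk.
have nzc : j.+1%:R * b ^+ j != 0 by rewrite mulf_neq0 ?expf_neq0.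
have [r Dr] := expand (j.+1%:R * b ^+ j)^-1 j.
exists (b%:P + (j.+1%:R * b ^+ j)^-1%:P * Y); rewrite Dr divff // mul1r.
have -> : (b ^+ j.+1)%:P + Y + r * (Y * Y) - 'X = r * (Y * Y) by rewrite /Y; ring.
exact: dvdp_mulIr.
Qed.

End PowerRoots.

(** * Sums of two k-th powers of the base field *)

Section Combinatorics.
Variables (F : finFieldType) (k : nat).
Hypothesis k_gt0 : (0 < k)%N.

Definition powers : {set F} := [set y ^+ k | y in predC1 (0 : F)].
Local Notation K := powers.

Lemma powersP a : reflect (exists2 y, y != 0 & a = y ^+ k) (a \in K).
Proof. by apply: (iffP imsetP) => -[y nzy ->]; exists y. Qed.

Lemma powers1 : 1 \in K.
Proof. by apply/powersP; exists 1; rewrite ?oner_eq0 ?expr1n. Qed.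

Lemma powers_neq0 a : a \in K -> a != 0.
Proof. by case/powersP => y nzy ->; apply: expf_neq0. Qed.

Lemma powersM a b : a \in K -> b \in K -> a * b \in K.
Proof.
move=> /powersP [y nzy ->] /powersP [z nzz ->]; apply/powersP.
by exists (y * z); rewrite ?mulf_neq0 ?exprMn.
Qed.

Lemma powersV a : a \in K -> a^-1 \in K.
Proof.
by case/powersP => y nzy ->; apply/powersP; exists y^-1; rewrite ?invr_neq0 ?exprVn.
Qed.

(** The order of [K] divides q - 1, which is -1 in F. *)
Lemma card_powers_natr : #|K|%:R != 0 :> F.
Proof.
have E : (#|K| * nroots1 F k = #|F|.-1)%N.
  rewrite -(cardC1 (0 : F)) -[RHS]sum1_card.
  rewrite [RHS](partition_big (fun x => x ^+ k) (mem K)) => [|x nzx]; last first.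
    exact: (imset_f (fun y => y ^+ k) nzx).
  rewrite -sum_nat_const; apply: eq_bigr => v /powersP [y nzy Dv].
  rewrite -(nroots_pow k nzy) -Dv /nroots -sum1_card; apply: eq_bigl => x.
  rewrite !inE andb_idl // => /eqP xv; apply: contraNneq nzy => x0.
  by have /eqP := Dv; rewrite -xv x0 expr0n gtn_eqF // mulr0n eq_sym expf_eq0 k_gt0.
apply/eqP => K0; have := congr1 (fun i => i%:R : F) E.
rewrite natrM K0 mul0r -subn1 natrB ?card_finField_natr; last first.
  by rewrite ltnW ?finNzRing_gt1.
by move/eqP; rewrite sub0r eq_sym oppr_eq0 oner_eq0.
Qed.

(* Otherwise K, uK and vK are disjoint, while squaring is at most two-to-one. *)
Lemma sqr_powers_ratio u v : u != 0 -> v != 0 -> u ^+ 2 \in K -> v ^+ 2 \in K ->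
  u \notin K -> v \notin K -> u / v \in K.
Proof.
move=> nzu nzv u2 v2 Ku Kv; apply: contraT => Kuv.
have disj a b : a != 0 -> b != 0 -> a / b \notin K ->
    [disjoint [set a * c | c in K] & [set b * c | c in K]].
  move=> nza nzb Kab; rewrite -setI_eq0; apply/eqP/setP => x; rewrite !inE.
  apply/negP => /andP [/imsetP [c Kc ->] /imsetP [c' Kc' Dx]].
  case/negP: Kab; have -> : a / b = c' * c^-1.
    by apply/(mulIf (powers_neq0 Kc))/(mulfI nzb); rewrite mulfVK ?powers_neq0 // -Dx; field.
  by rewrite powersM ?powersV.
have cardS a : a != 0 -> #|[set a * c | c in K]| = #|K|.
  by move=> nza; rewrite card_imset //; apply: mulfI.
have sub : [set 1 * c | c in K] :|: [set u * c | c in K] :|: [set v * c | c in K]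
    \subset [set x : F | x ^+ 2 \in K].
  apply/subsetP => x; rewrite !inE -orbA => /or3P [] /imsetP [c Kc ->];
    by rewrite exprMn; apply: powersM; rewrite ?expr1n ?powers1 // [c ^+ 2]expr2 powersM.
have le2 := leq_trans (subset_leq_card sub) (card_power_preim (isT : (0 < 2)%N) K).
have := leq_trans le2 (leq_mul (@nroots1_leq F 2 isT) (leqnn _)).
have K_gt0 : (0 < #|K|)%N by apply/card_gt0P; exists 1; apply: powers1.
have cardU (A B : {set F}) : [disjoint A & B] -> #|A :|: B| = (#|A| + #|B|)%N.
  by move=> dAB; apply/eqP; rewrite (leq_card_setU A B).
rewrite !cardU ?cardS ?oner_eq0 //; first by lia.
- by rewrite disj ?oner_eq0 // div1r; apply: contra Ku => /powersV; rewrite invrK.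
rewrite -setI_eq0 setIUl setU_eq0 !setI_eq0 !disj ?oner_eq0 // div1r.
by apply: contra Kv => /powersV; rewrite invrK.
Qed.

Hypothesis two_neq0 : 2%:R != 0 :> F.

(* If x ^+ k = u lies in F for some x in the quadratic extension, then the trace
   u + u of x ^+ k need not be the trace of an irreducible polynomial; by taking
   norms, u ^+ 2 is a k-th power in F. *)
Definition bad (s : F) :=
  [exists u, [&& s == u + u, u != 0, u ^+ 2 \in K & u \notin K]].

(** The sum 0 + 0 is left out: for k > 1, 'X is not a k-th power modulo 'X^2. *)
Definition sum2 := K :|: [set a + b | a in K, b in K].

Lemma sum2P t : reflect (t \in K \/ exists a b, [/\ a \in K, b \in K & t = a + b])
  (t \in sum2).
Proof.
rewrite inE; apply: (iffP orP) => -[Kt|].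
- by left.
- by case/imset2P => a b Ka Kb ->; right; exists a, b.
- by left.
by case=> a [b [Ka Kb ->]]; right; apply/imset2P; exists a b.
Qed.

Lemma bad_ratio s s' : bad s -> bad s' -> s / s' \in K.
Proof.
case/existsP => u /and4P [/eqP -> nzu u2 Ku].
case/existsP => v /and4P [/eqP -> nzv v2 Kv].
have -> : (u + u) / (v + v) = u / v by field; rewrite nzv -mulr2n -mulr_natl mulf_neq0.
exact: sqr_powers_ratio.
Qed.

Lemma sum2_cover t :
  exists2 tau, tau \in sum2 & (t - tau \in sum2) || (t != tau) && ~~ bad (t - tau).
Proof.
apply/exists_inP; apply: contraT; rewrite negb_exists_in => /forall_inP H.
have {}H tau : tau \in sum2 -> t - tau \notin sum2 /\ (t != tau -> bad (t - tau)).
  move=> /H; rewrite negb_or negb_and !negbK => /andP [-> /orP [/eqP -> | ->]] //.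
  by rewrite eqxx.
have inK a : a \in K -> a \in sum2 by move=> Ka; apply/sum2P; left.
have inKK a b : a \in K -> b \in K -> a + b \in sum2.
  by move=> Ka Kb; apply/sum2P; right; exists a, b.
have [/sum2P [Kt | [a [b [Ka Kb Dt]]]] | St] := boolP (t \in sum2); last 1 first.
  (* Here K + 1 = K; summing over K gives #|K| = 0 in F. *)
- have badt tau : tau \in sum2 -> bad (t - tau).
    by move=> Stau; apply: (H _ Stau).2; apply: contraNneq St => ->.
  pose r := t - 1; have bad_r : bad r by apply/badt/inK/powers1.
  have nzr : r != 0.
    by apply: contraNneq St => /eqP; rewrite subr_eq0 => /eqP ->; apply/inK/powers1.
  have ratio tau : tau \in sum2 -> (t - tau) / r \in K.
    by move=> Stau; apply: bad_ratio => //; apply: badt.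
  (* The map sends [K] injectively into [K], hence onto it; as it also sends c + 1 into [K],
     injectivity gives c + 1 in [K]. *)
  have imK : [set (t - c) / r | c in K] = K.
    apply/eqP; rewrite eqEcard; apply/andP; split.
      by apply/subsetP => _ /imsetP [c Kc ->]; apply/ratio/inK.
    by rewrite [leqRHS]card_imset // => c c' /(mulIf (invr_neq0 nzr))/addrI/oppr_inj.
  have add1 : [set c + 1 | c in K] = K.
    apply/eqP; rewrite eqEcard; apply/andP; split; last first.
      by rewrite [leqRHS]card_imset //; apply: addIr.
    apply/subsetP => _ /imsetP [c Kc ->].
    have : (t - (c + 1)) / r \in K by apply/ratio/inKK/powers1.
    by rewrite -{1}imK => /imsetP [c' Kc' /(mulIf (invr_neq0 nzr))/addrI/oppr_inj ->].
  have := card_powers_natr; rewrite -[X in X != 0](addKr (\sum_(c in K) c)).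
  rewrite -sum1_card natr_sum -big_split /= -{1}add1 big_imset /=; last first.
    by move=> c c' _ _; apply: addIr.
  by rewrite addNr eqxx.
- have bad_opp c : c \in K -> bad (- c).
    move=> Kc; have -> : - c = t - (t + c) by ring.
    apply: (H _ (inKK _ _ Kt Kc)).2.
    by rewrite eq_sym addrC -subr_eq0 addrK powers_neq0.
  have [/existsP [c /andP [Kc ne_ct]] | /existsPn allK] := boolP [exists c, (c \in K) && (c != t)].
    have : (t - c) / - t \in K.
      by apply: bad_ratio; [apply: (H _ (inK _ Kc)).2; rewrite eq_sym | apply: bad_opp].
    have nzt := powers_neq0 Kt; have nzc := powers_neq0 Kc.
    have -> : (t - c) / - t = c / t - 1 by rewrite invrN mulrN -mulNr opprB mulrBl divff.
    (* The choice tau = t^2 / c makes t - tau equal to (c / t - 1) tau, a product of two elements of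
       [K]. *)
    move=> Kct; case: (H (t * (t / c))); first by rewrite inK ?powersM ?powersV.
    have -> : t - t * (t / c) = (c / t - 1) * (t * (t / c)) by field; rewrite nzc.
    by rewrite inK // !powersM ?powersV.
  have K1 c : c \in K -> c = 1.
    have t1 : t = 1.
      by have := allK 1; rewrite powers1 negbK => /eqP.
    by move=> Kc; have := allK c; rewrite Kc negbK t1 => /eqP.
  case/existsP: (bad_opp 1 powers1) => u /and4P [/eqP Du nzu /K1/eqP].
  rewrite sqrf_eq1 => /orP [/eqP -> | /eqP Du']; first by rewrite powers1.
  move: Du; rewrite Du' => /eqP; rewrite -subr_eq0 opprD opprK addrA addNr add0r.
  by rewrite oner_eq0.
by case: (H a (inK a Ka)) => /negP []; rewrite Dt addrC addKr inK.
Qed.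

End Combinatorics.

(** * Matching traces *)

(** As x^k generates L, x itself is h(x^k) for some h, so the minimal polynomial of x^k divides h^k
    - 'X. *)
Lemma generator_power_root (F : finFieldType) (L0 : fieldExtType F) k
    (x : finvect_type L0) : generates (x ^+ k) -> exists f : {poly F},
  [/\ f \is monic, size f = (\dim {:L0}).+1, has_power_root k f,
      (- f`_(\dim {:L0}).-1)%:A = Tr (x ^+ k) &
      forall c, (1 < \dim {:L0})%N -> ~~ root f c].
Proof.
move=> gen_x; have [f [f_mon szf trf dvdf polyf]] := generator_poly gen_x.
exists f; split=> // [|c n_gt1].
  have [h Dx] := polyf x; exists h.
  by rewrite dvdf rmorphB rmorphXn /= map_polyX /root !hornerE -Dx subrr.
apply/negP => fc0; have /factor_theorem [p Df] := fc0.
have := dvdpp f; rewrite {2}Df dvdf rmorphM rootM /= => /orP [|].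
  rewrite -dvdf => /dvdp_leq; have nzp : p != 0.
    by apply: contraTneq f_mon => p0; rewrite Df p0 mul0r monicE lead_coef0 eq_sym oner_eq0.
  move/(_ nzp); rewrite Df size_Mmonic ?monicXsubC // size_XsubC addn2 /=.
  by rewrite ltnn.
rewrite -dvdf => /dvdp_leq; rewrite polyXsubC_eq0 size_XsubC szf => /(_ isT).
by rewrite ltnS leqNgt n_gt1.
Qed.

Lemma coef1_XsubC_mul (R : comNzRingType) (a b : R) :
  (('X - a%:P) * ('X - b%:P))`_1 = - (a + b).
Proof.
rewrite mulrBl coefB coefXM coefCM !coefB !coefX !coefC /=.
by rewrite subr0 sub0r mulr1 -opprD addrC.
Qed.

(** * Matching traces for n = 2 *)

Section Quadratic.
Variables (F : finFieldType) (k : nat).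
Hypotheses (k_gt0 : (0 < k)%N) (k_lt : ((k - 1) ^ 2 < #|F|)%N).
Local Notation q := #|F|.

Definition quad_trace (s : F) := exists f : {poly F},
  [/\ f \is monic, size f = 3, has_power_root k f & - f`_1 = s].

Lemma quad_trace_XsubC (a b : F) :
  has_power_root k (('X - a%:P) * ('X - b%:P)) -> quad_trace (a + b).
Proof.
move=> ab; exists (('X - a%:P) * ('X - b%:P)); split=> //.
- by rewrite monicMl monicXsubC.
- by rewrite size_Mmonic ?monicXsubC ?polyXsubC_eq0 // !size_XsubC.
by rewrite coef1_XsubC_mul opprK.
Qed.

Lemma has_power_root_X_power (y : F) : y != 0 ->
  has_power_root k (('X - 0%:P) * ('X - (y ^+ k)%:P)).
Proof.
move=> nzy; have -> : 0 = 0 ^+ k :> F by rewrite expr0n gtn_eqF.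
by apply: has_power_root_XsubC_pair; rewrite expr0n gtn_eqF // eq_sym expf_neq0.
Qed.

Lemma sum2_power_root t : k%:R != 0 :> F -> t \in sum2 F k ->
  exists a b, has_power_root k (('X - a%:P) * ('X - b%:P)) /\ t = a + b.
Proof.
move=> nzk /sum2P [/powersP [y nzy ->] | [_ [_ [/powersP [y nzy ->] /powersP [z nzz ->] ->]]]].
  by exists 0, (y ^+ k); rewrite add0r; split=> //; apply: has_power_root_X_power.
exists (y ^+ k), (z ^+ k); split=> //.
have [<-|ne_yz] := eqVneq (y ^+ k) (z ^+ k); first exact: has_power_root_XsubC_sqr.
exact: has_power_root_XsubC_pair.
Qed.

(** Otherwise q - 1 <= k, and (q - 2)^2 < q leaves only q = 3. *)
Lemma exists_nontrivial_power : (q != 3)%N -> (2 < q)%N ->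
  exists2 y : F, y != 0 & y ^+ k != 1.
Proof.
move=> q3 q_gt2; have [/existsP [y /andP [nzy y1]] | /existsPn all1] :=
  boolP [exists y : F, (y != 0) && (y ^+ k != 1)]; first by exists y.
have : (q.-1 <= k)%N.
  apply: leq_trans (nroots1_leq F k_gt0); rewrite -(cardC1 (0 : F)).
  apply/subset_leq_card/subsetP => y; rewrite !inE => nzy.
  by have := all1 y; rewrite nzy /= negbK.
move: k_lt q3 q_gt2; move: q => c lt_c /eqP c3 c_gt2 le_c.
have : ((c - 2) ^ 2 < c)%N by apply: leq_ltn_trans lt_c; rewrite leq_exp2r //; lia.
by rewrite -mulnn; nia.
Qed.

Section Ext.
Variables (L0 : fieldExtType F).
Hypothesis dimL : \dim {:L0} = 2.
Local Notation L := (finvect_type L0).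

Lemma quad_not_generates (u : L) : ~~ generates u -> exists c : F, u = c%:A.
Proof.
case/not_generates => m []; rewrite dimL; case: m => [|[|m]] // _ _ _.
by rewrite expn1; apply: expq_fix.
Qed.

Lemma quad_TrE (x : L) : Tr x = x + x ^+ q.
Proof. by rewrite /Tr dimL !big_ord_recl big_ord0 addr0 expr1 expn1. Qed.

Lemma quad_trace_generates (x : L) s :
  generates (x ^+ k) -> Tr (x ^+ k) = s%:A -> quad_trace s.
Proof.
move=> gen_x Tx; have [f [f_mon szf rf trf _]] := generator_power_root gen_x.
rewrite dimL in szf trf; exists f; split=> //.
move: trf; rewrite Tx => /eqP; rewrite -subr_eq0 -scalerBl scaler_eq0 oner_eq0 orbF.
by rewrite subr_eq0 => /eqP.
Qed.

Lemma in_alg_inj (a b : F) : a%:A = b%:A :> L -> a = b.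
Proof.
by move/eqP; rewrite -subr_eq0 -scalerBl scaler_eq0 oner_eq0 orbF subr_eq0 => /eqP.
Qed.

Lemma quad_Tr_not_generates (x : L) s : ~~ generates (x ^+ k) ->
  Tr (x ^+ k) = s%:A -> exists2 c : F, x ^+ k = c%:A & s = c + c.
Proof.
move=> /quad_not_generates [c Dc]; rewrite quad_TrE Dc => Ts; exists c => //.
apply: in_alg_inj; rewrite -Ts scalerDl; congr (_ + _).
by have := @expq_in_alg F L0 c 1; rewrite expn1.
Qed.

Lemma quad_level_count s : s != 0 ->
  (#|[set x : L | Tr (x ^+ k) == s%:A]|%:R - q%:R) ^+ 2 <=
    ((nroots1 L k)%:R - 1) ^+ 2 * q%:R :> rat.
Proof. by move=> nzs; have := card_power_trace_bound L0 k_gt0 nzs; rewrite dimL expn1. Qed.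

Lemma quad_exists_trace s : s != 0 -> exists x : L, Tr (x ^+ k) = s%:A.
Proof.
move=> nzs; have := quad_level_count nzs.
have [->|[x]] := set_0Vmem [set x : L | Tr (x ^+ k) == s%:A]; last first.
  by rewrite inE => /eqP Tx _; exists x.
rewrite cards0 sub0r sqrrN expr2 ler_pM2r ?ltr0n ?(ltnW (finNzRing_gt1 F)) //.
have d_gt0 := nroots1_gt0 L k; have le_d := nroots1_leq L k_gt0.
have -> : (nroots1 L k)%:R - 1 = (nroots1 L k - 1)%:R :> rat by rewrite natrB.
rewrite -natrX ler_nat leqNgt => /negP []; apply: leq_ltn_trans k_lt.
by rewrite leq_exp2r // leq_sub2r.
Qed.

Lemma quad_trace_char2 s : 2%:R = 0 :> F -> s != 0 -> quad_trace s.
Proof.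
move=> F2 nzs; have [x Tx] := quad_exists_trace nzs.
have [|ngen] := boolP (generates (x ^+ k)); first by move/quad_trace_generates; apply.
have [c _ Ds] := quad_Tr_not_generates ngen Tx.
by move: nzs; rewrite Ds -mulr2n -mulr_natl F2 mul0r eqxx.
Qed.

Lemma nroots1_pchar p : p \in [pchar F] -> (p %| k)%N -> (p * nroots1 L k <= k)%N.
Proof.
move=> pF /dvdnP [j Dk]; have pL : p \in [pchar L] by rewrite pchar_lalg.
have j_gt0 : (0 < j)%N by move: k_gt0; rewrite Dk muln_gt0 => /andP [].
suffices -> : nroots1 L k = nroots1 L j.
  by rewrite Dk mulnC leq_mul2r nroots1_leq ?orbT.
apply: eq_card => x; rewrite !inE Dk exprM -(pFrobenius_autE pL).
by rewrite -[RHS](inj_eq (fmorph_inj (pFrobenius_aut pL))) rmorph1.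
Qed.

(** Since the characteristic p >= 3 divides k, there are d <= k / 3 roots of unity, so (3d - 1)^2 <
    q. A non-generating power of trace s must be s / 2, which accounts for at most d elements x,
    fewer than the second moment bound requires. *)
Lemma quad_trace_dvd s : 2%:R != 0 :> F -> k%:R = 0 :> F -> s != 0 -> quad_trace s.
Proof.
move=> F2 k0 nzs; have [p p_pr pF] := finPcharP F.
have p_gt2 : (2 < p)%N.
  by rewrite ltn_neqAle prime_gt1 // andbT; apply: contraNneq F2 => ->; rewrite pcharf0.
have dv_p : (p %| k)%N by rewrite (dvdn_pcharf pF) k0.
have le_dk := nroots1_pchar pF dv_p; have d_gt0 := nroots1_gt0 L k.
have [/existsP [x /andP [gen_x /eqP Tx]] | /existsPn no_gen] :=
  boolP [exists x : L, generates (x ^+ k) && (Tr (x ^+ k) == s%:A)].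
  exact: quad_trace_generates gen_x Tx.
have sub : [set x : L | Tr (x ^+ k) == s%:A] \subset
    [set x : L | x ^+ k \in [set (s / 2%:R)%:A]].
  apply/subsetP => x; rewrite !inE => Tx; have := no_gen x; rewrite Tx andbT.
  case/quad_Tr_not_generates/(_ (eqP Tx)) => c -> ->.
  by rewrite -[c + c]mulr2n -[c *+ 2]mulr_natr mulfK.
have := leq_trans (subset_leq_card sub) (card_power_preim k_gt0 _).
rewrite cards1 muln1 => leN; have := quad_level_count nzs.
have dq : ((3 * nroots1 L k - 1) ^ 2 < q)%N.
  apply: leq_ltn_trans k_lt; rewrite leq_exp2r // leq_sub2r //.
  by apply: leq_trans le_dk; rewrite leq_mul2r p_gt2 orbT.
set N := #|_| in leN *; set d := nroots1 L k in d_gt0 dq leN *.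
have dq' : (9 * d ^ 2 + 2 <= q + 6 * d)%N.
  by move: dq; rewrite -!mulnn; nia.
have {}dq' : 9 * d%:R ^+ 2 + 2 <= q%:R + 6 * d%:R :> rat.
  by rewrite -natrX -!natrM -!natrD ler_nat.
have d1 : 1 <= d%:R :> rat by rewrite ler1n.
have {}leN : N%:R <= d%:R :> rat by rewrite ler_nat.
have N0 : 0 <= N%:R :> rat by apply: ler0n.
set x := N%:R in leN N0 *; set y := d%:R in d1 dq' leN *; set z := q%:R in dq' *.
clearbody x y z => bound; exfalso.
have y2 : y <= y ^+ 2 by nra.
have z0 : 0 < z by lra.
have : 0 < z * (z - 2 * x - (y - 1) ^+ 2) by apply: mulr_gt0 => //; nra.
have := sqr_ge0 x; nra.
Qed.

Lemma quad_trace_not_bad s : s != 0 -> ~~ bad k s -> quad_trace s \/ s \in sum2 F k.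
Proof.
move=> nzs; have [x Tx] := quad_exists_trace nzs.
have [|ngen] := boolP (generates (x ^+ k)).
  by move/quad_trace_generates/(_ Tx); left.
have [c Dc Ds] := quad_Tr_not_generates ngen Tx.
have nzc : c != 0 by apply: contraNneq nzs => c0; rewrite Ds c0 addr0.
rewrite /bad => /existsPn/(_ c); rewrite Ds eqxx nzc /= negb_and negbK.
have nzx : x != 0.
  apply: contraNneq nzc => x0; have := Dc; rewrite x0 expr0n gtn_eqF // => /esym/eqP.
  by rewrite scaler_eq0 oner_eq0 orbF.
have -> /= : c ^+ 2 \in powers F k.
  (* z is the norm of x; taking norms in x^k = c gives z^k = c^2. *)
  have [z Dz] : exists z : F, x ^+ q.+1 = z%:A.
    have x2 : x ^+ (q * q) = x by rewrite mulnn -[X in (q ^ X)%N]dimL -card_ext expf_card.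
    by apply: expq_fix; rewrite -exprM mulSn exprD x2 exprS mulrC.
  apply/powersP; exists z.
    apply: contraNneq nzx => z0; move/eqP: Dz.
    by rewrite z0 scale0r expf_eq0.
  have AX (a : F) j : (a ^+ j)%:A = a%:A ^+ j :> L by rewrite exprZn expr1n.
  apply: in_alg_inj; rewrite !AX -Dz -Dc.
  rewrite -[RHS]exprM mulnC exprM [RHS]exprS expr2 Dc; congr (_ * _).
  by have := @expq_in_alg F L0 c 1; rewrite expn1.
by move=> Kc; right; apply/sum2P; right; exists c, c.
Qed.

End Ext.

(** If every nonzero s is a [quad_trace], it suffices to take a = 0 and b a nonzero k-th power other
    than t; two such powers exist because q = 3 is impossible in these cases. Otherwise [sum2_cover]
    chooses a + b. *)
Lemma quad_trace_split t : (2 < q)%N -> exists s a b,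
  [/\ quad_trace s, has_power_root k (('X - a%:P) * ('X - b%:P)) & t = s + (a + b)].
Proof.
move=> q_gt2; have [L0 dimL] := @finField_extension F 2 isT.
have two_powers : (q != 3)%N -> (forall s, s != 0 -> quad_trace s) -> exists s a b,
    [/\ quad_trace s, has_power_root k (('X - a%:P) * ('X - b%:P)) & t = s + (a + b)].
  move=> q3 allT; have [y nzy y1] := exists_nontrivial_power q3 q_gt2.
  have split1 z : z != 0 -> t != z ^+ k -> exists s a b,
    [/\ quad_trace s, has_power_root k (('X - a%:P) * ('X - b%:P)) & t = s + (a + b)].
    move=> nzz ne_tz; exists (t - z ^+ k), 0, (z ^+ k); rewrite add0r subrK.
    by split=> //; [apply: allT; rewrite subr_eq0 | apply: has_power_root_X_power].
  have [t1|ne_t1] := eqVneq t 1; last by apply: (split1 1); rewrite ?oner_neq0 ?expr1n.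
  by apply: (split1 y); rewrite // t1 eq_sym.
have [F2|F2] := eqVneq (2%:R : F) 0.
  apply: two_powers => [|s]; last exact: (quad_trace_char2 dimL).
  apply/eqP => q3; have := card_finField_natr F; rewrite q3 -natr1 F2 add0r.
  by apply/eqP/oner_neq0.
have [k0|nzk] := eqVneq (k%:R : F) 0.
  apply: two_powers => [|s]; last exact: (quad_trace_dvd dimL).
  apply/eqP => q3; have [p p_pr pF] := finPcharP F.
  have : (p %| k)%N by rewrite (dvdn_pcharf pF) k0.
  have p_gt2 : (2 < p)%N.
    by rewrite ltn_neqAle prime_gt1 // andbT; apply: contraNneq F2 => ->; rewrite pcharf0.
  move/(dvdn_leq k_gt0) => le_pk; move: k_lt; rewrite q3.
  by rewrite -mulnn; nia.
have [tau Stau St] := sum2_cover k_gt0 F2 t.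
have [a [b [rab Dtau]]] := sum2_power_root nzk Stau.
have quad_sum2 s : s \in sum2 F k -> quad_trace s.
  by case/(sum2_power_root nzk) => c [d [rcd ->]]; apply: quad_trace_XsubC.
exists (t - tau), a, b; split=> //; last by rewrite -Dtau subrK.
case/orP: St => [/quad_sum2 //|/andP [ne_t nbad]].
have nz : t - tau != 0 by rewrite subr_eq0.
by case: (quad_trace_not_bad dimL nz nbad) => // /quad_sum2.
Qed.

End Quadratic.

(** * Scalar and non-scalar matrices *)

Lemma scalar_sum_powers (F : finFieldType) m k (a : F) :
    (0 < k)%N -> ((k - 1) ^ 4 < #|F| ^ m.+1)%N ->
  exists B C : 'M[F]_m.+1, a%:M = B ^+ k + C ^+ k.
Proof.
move=> k_gt0 lt_k; have [->|nza] := eqVneq a 0.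
  by exists 0, 0; rewrite expr0n gtn_eqF // addr0 raddf0.
have [L0 dimL] := finField_extension F (ltn0Sn m); pose L := finvect_type L0.
have nzaA : a%:A != 0 :> L by rewrite scaler_eq0 (negPf nza) oner_eq0.
have lt_d : ((nroots1 L k - 1) ^ 4 < #|L|)%N.
  rewrite card_ext dimL; apply: leq_ltn_trans lt_k.
  by rewrite leq_exp2r // leq_sub2r // nroots1_leq.
have [x [y Dxy]] := sum_two_powers k_gt0 nzaA lt_d.
(* Exponent 1 provides a plain generator of L, whose companion matrix embeds L in the matrices. *)
have [u gen_u] : exists u : L, generates (u ^+ 1).
  apply: exists_generating_power => //; rewrite exp0n // dimL expn_gt0.
  by rewrite ltnW ?finNzRing_gt1.
rewrite expr1 in gen_u; have [f [f_mon szf _ dvdf polyf]] := generator_poly gen_u.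
have [hx Dx] := polyf x; have [hy Dy] := polyf y.
have : f %| hx ^+ k + hy ^+ k - a%:P.
  rewrite dvdf rmorphB rmorphD !rmorphXn /= map_polyC /root !hornerE -Dx -Dy Dxy.
  by rewrite subrr.
case/dvdpP => p Dp; rewrite dimL in szf.
have [M chM] : exists M : 'M[F]_m.+1, char_poly M = f.
  have := companionmxK f_mon; rewrite /companionmx szf /= => <-; eexists; reflexivity.
exists (horner_mx M hx), (horner_mx M hy); rewrite -!rmorphXn -rmorphD.
apply/eqP; rewrite eq_sym -subr_eq0 -(horner_mx_C M a) -rmorphB Dp rmorphM /= -chM.
by rewrite Cayley_Hamilton mulr0.
Qed.

Lemma nonscalar_sum_powers (F : finFieldType) m k (A : 'M[F]_m.+1) :
    (2 < #|F|)%N -> (0 < k)%N -> ((k - 1) ^ 4 < #|F| ^ m.+1)%N -> ~~ is_scalar_mx A ->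
  exists B C : 'M[F]_m.+1, A = B ^+ k + C ^+ k.
Proof.
move=> q_gt2 k_gt0 lt_k nscA.
have cardF : exists c : F, (c != 0) && (c != 1).
  have [E|[c]] := set_0Vmem (~: [set (0 : F); 1]); last first.
    by rewrite !inE negb_or; exists c.
  by move: q_gt2; rewrite -(cardsC [set (0 : F); 1]) E cards0 addn0 cards2; case: (_ != _).
have finish f c g : has_power_root k f -> has_power_root k (('X - c%:P) * g) ->
    f \is monic -> size f = m.+2 -> g \is monic -> size g = m.+1 ->
    - f`_m - (('X - c%:P) * g)`_m = \tr A ->
    exists B C : 'M[F]_m.+1, A = B ^+ k + C ^+ k.
  move=> rf rg f_mon szf g_mon szg trA.
  have [B [C [-> chB chC]]] := nonscalar_sum cardF nscA f_mon szf g_mon szg trA.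
  have [X ->] : exists X, B = X ^+ k by apply: power_of_char_poly; rewrite chB.
  have [Y ->] : exists Y, C = Y ^+ k by apply: power_of_char_poly; rewrite chC.
  by exists X, Y.
have m_gt0 : (0 < m)%N.
  case: m A nscA {lt_k finish} => // A /is_scalar_mxP [].
  by exists (A 0 0); apply/matrixP => i j; rewrite !ord1 mxE.
have [m1|m_gt1] : m = 1%N \/ (1 < m)%N by lia.
  have lt_k2 : ((k - 1) ^ 2 < #|F|)%N.
    by rewrite -(ltn_exp2r _ _ (isT : (0 < 2)%N)) -expnM; rewrite m1 in lt_k.
  have [s [a [b [[f [f_mon szf rf Ds]] rab Dt]]]] :=
    quad_trace_split k_gt0 lt_k2 (\tr A) q_gt2.
  apply: (finish f a ('X - b%:P)); rewrite ?monicXsubC ?size_XsubC ?Dt ?m1 //.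
  by rewrite coef1_XsubC_mul opprK Ds.
have [L0 dimL] := finField_extension F (ltn0Sn m).
have [L1 dimL1] := finField_extension F m_gt0.
have [w gen_w] : exists w : finvect_type L1, generates (w ^+ k).
  apply: exists_generating_power => //; rewrite dimL1.
  rewrite -(ltn_exp2r _ _ (isT : (0 < 2)%N)) -!expnM; apply: leq_trans lt_k _.
  by rewrite leq_exp2l //; lia.
have [g [g_mon szg rg _ no_root]] := generator_power_root gen_w.
rewrite dimL1 in szg no_root.
(* [s c] is the trace left for f; it has to be nonzero, and [s 0] and [s 1] differ by 1. *)
pose s c := \tr A + (('X - c%:P) * g)`_m.
have Ds c : s c = s 0 - c.
  rewrite /s !mulrBl !coefB !coefCM mul0r subr0 -addrA; congr (_ + (_ - _)).
  by have := monicP g_mon; rewrite lead_coefE szg /= => ->; rewrite mulr1.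
have [y nzs] : exists y : F, s (y ^+ k) != 0.
  have [s0|] := eqVneq (s 0) 0; last first.
    by exists 0; rewrite expr0n gtn_eqF.
  by exists 1; rewrite expr1n Ds s0 sub0r oppr_eq0 oner_eq0.
have [x gen_x Tx] : exists2 x : finvect_type L0, generates (x ^+ k) &
    Tr (x ^+ k) = (s (y ^+ k))%:A.
  by apply: exists_power_trace; rewrite ?dimL.
have [f [f_mon szf rf trf _]] := generator_power_root gen_x.
rewrite dimL in szf trf; apply: (finish f (y ^+ k) g) => //.
  apply: has_power_root_mul; rewrite ?rg //; last exact: has_power_root_XsubC.
  by rewrite coprimep_sym coprimep_XsubC no_root.
have -> : - f`_m = s (y ^+ k) by apply: (@in_alg_inj F L0); rewrite -Tx -trf.
by rewrite /s addrK.
Qed.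

Theorem corollary2p14 (F : finFieldType) (hq : #|F| <> 2%N)
    (n k : nat) (hn : (0 < n)%N) (hk : (0 < k)%N)
    (hnk : ((k - 1) ^ 4 < #|F| ^ n)%N) (A : 'M[F]_n) :
  exists B C : 'M[F]_n, A = B ^+ k + C ^+ k.
Proof.
case: n hn hnk A => // m _ lt_k A.
have q_gt2 : (2 < #|F|)%N.
  by rewrite ltn_neqAle finNzRing_gt1 andbT eq_sym; apply/eqP.
have [/is_scalar_mxP [a ->]|] := boolP (is_scalar_mx A).
  exact: scalar_sum_powers.
exact: nonscalar_sum_powers.
Qed.
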